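(* Suppose that $\varphi:\mathbb R^n\to\overline{\mathbb R}$ is twice differentiable at $\bar x\in\mathbb R^n$ in the extended sense, $\psi:\mathbb R^n\to\overline{\mathbb R}$ is proper and lower semicontinuous around $\bar x$, and $\bar v\in\partial(\varphi+\psi)(\bar x)$. Then for every $w\in\mathbb R^n$ $$D(\partial(\varphi+\psi))(\bar x|\bar v)(w)=\nabla^2\varphi(\bar x)w+D(\partial\psi)\big(\bar x|\bar v-\nabla\varphi(\bar x)\big)(w),$$ $$d^2(\varphi+\psi)(\bar x|\bar v)(w)=\langle w,\nabla^2\varphi(\bar x)w\rangle+d^2\psi\big(\bar x|\bar v-\nabla\varphi(\bar x)\big)(w),$$ and, for every $w\in\mathbb R^n$ with $d\psi(\bar x)(w)\in\mathbb R$ and every $z\in\mathbb R^n$, $$d^2(\varphi+\psi)(\bar x)(w|z)=\langle w,\nabla^2\varphi(\bar x)w\rangle+\nabla\varphi(\bar x)z+d^2\psi(\bar x)(w|z).$$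
   Context: $\overline{\mathbb R}:=\mathbb R\cup\{\infty\}$; $\operatorname{dom}f=\{x:f(x)<\infty\}$. ''Lower semicontinuous around $\bar x$'' means lower semicontinuous at every point of some neighborhood of $\bar x$. Extended twice differentiability: $f:\mathbb R^n\to\overline{\mathbb R}$, finite at $\bar x$, is twice differentiable at $\bar x$ in the extended sense if it is differentiable at $\bar x$ and there exist an $n\times n$ matrix $A$, a neighborhood $U$ of $\bar x$ and $D\subset U$ with $\mu(U\setminus D)=0$ ($\mu$ Lebesgue measure) such that $f$ is (finite and) Lipschitz on $U$, differentiable at every point of $D$, and $\lim_{x\to\bar x,\,x\in D}\frac{\nabla f(x)-\nabla f(\bar x)-A(x-\bar x)}{\|x-\bar x\|}=0$. The (unique) matrix $A$ is denoted $\nabla^2f(\bar x)$. $\nabla f(\bar x)z$ means $\langle\nabla f(\bar x),z\rangle$. Subdifferentials: for $\bar x\in\operatorname{dom}f$, $\widehat\partial f(\bar x)=\{v:\liminf_{x\to\bar x}\frac{f(x)-f(\bar x)-\langle v,x-\bar x\rangle}{\|x-\bar x\|}\ge0\}$, and the limiting subdifferential $\partial f(\bar x)$ is the set of $v$ for which there are $x_k\to\bar x$ with $f(x_k)\to f(\bar x)$ and $v_k\to v$ with $v_k\in\widehat\partial f(x_k)$. Both are empty if $\bar x\notin\operatorname{dom}f$. Subderivative: $df(\bar x)(w)=\liminf_{t\downarrow0,\,w'\to w}\frac{f(\bar x+tw')-f(\bar x)}{t}$. Second subderivative: $d^2f(\bar x|v)(w)=\liminf_{t\downarrow0,\,w'\to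 w}\frac{f(\bar x+tw')-f(\bar x)-t\langle v,w'\rangle}{\frac12t^2}$. Parabolic subderivative (defined for $w$ with $df(\bar x)(w)\in\mathbb R$): $d^2f(\bar x)(w|z)=\liminf_{t\downarrow0,\,z'\to z}\frac{f(\bar x+tw+\frac12t^2z')-f(\bar x)-t\,df(\bar x)(w)}{\frac12t^2}$. Tangent cone: $T_\Omega(\bar x)=\{v:\exists t_k\downarrow0,\ v_k\to v,\ \bar x+t_kv_k\in\Omega\ \forall k\}$ for $\bar x\in\Omega$. Subgradient graphical derivative of $f$ at $\bar x$ for $\bar v\in\partial f(\bar x)$: $D(\partial f)(\bar x|\bar v)(w):=\{z:(w,z)\in T_{\operatorname{gph}\partial f}(\bar x,\bar v)\}$. *)

(* Defs.v *)
From HB Require Import structures.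
From mathcomp Require Import all_boot all_order all_algebra.
From mathcomp Require Import all_classical all_reals all_analysis.
Set Implicit Arguments.
Unset Strict Implicit.
Unset Printing Implicit Defensive.
Import Order.TTheory GRing.Theory Num.Theory.
Import numFieldNormedType.Exports.
Local Open Scope classical_set_scope.
Local Open Scope ring_scope.

Definition dot (R : realType) (n : nat) (u v : 'rV[R]_n) : R :=
  \sum_i u ord0 i * v ord0 i.

(* The library norm on ['rV[R]_n] is the sup norm; the quotients below use the
   Euclidean norm.  Both induce the same topology and Lipschitz functions. *)
Definition enorm (R : realType) (n : nat) (u : 'rV[R]_n) : R :=
  Num.sqrt (dot u u).

(* Functions R^n -> R \cup {+oo} are functions into [\bar R] satisfying this. *)
Definition ninfty_free (R : realType) (T : Type) (f : T -> \bar R) : Prop :=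
  forall x, (-oo < f x)%E.

Definition proper_fun (R : realType) (T : Type) (f : T -> \bar R) : Prop :=
  ninfty_free f /\ exists x, (f x < +oo)%E.

Definition lsc_at (R : realType) (V : topologicalType) (f : V -> \bar R)
    (x : V) : Prop :=
  forall a : R, (a%:E < f x)%E -> \forall y \near x, (a%:E < f y)%E.

Definition lsc_around (R : realType) (V : topologicalType) (f : V -> \bar R)
    (x : V) : Prop :=
  \forall y \near x, lsc_at f y.

Definition box (R : realType) (n : nat) (a b : 'rV[R]_n) : set 'rV[R]_n :=
  [set x | forall i, a ord0 i <= x ord0 i <= b ord0 i].

Definition box_volume (R : realType) (n : nat) (a b : 'rV[R]_n) : R :=
  \prod_i Num.max 0 (b ord0 i - a ord0 i).

(* Lebesgue outer measure on R^n.  Since Lebesgue measure is complete, a set is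
   measurable of measure 0 iff its outer measure is 0.  Covers are indexed by
   sets of naturals so that the empty set is null for n = 0 too. *)
Definition lebesgue_outer (R : realType) (n : nat) (A : set 'rV[R]_n) : \bar R :=
  ereal_inf [set s | exists (I : set nat) (a b : nat -> 'rV[R]_n),
    A `<=` \bigcup_(k in I) box (a k) (b k) /\
    s = (\esum_(k in I) (box_volume (a k) (b k))%:E)%E].

Definition ediff (R : realType) (n : nat) (f : 'rV[R]_n -> \bar R)
    (x : 'rV[R]_n) : Prop :=
  (\forall y \near x, f y \is a fin_num) /\
  differentiable (fun y => fine (f y)) x.

Definition grad (R : realType) (n : nat) (f : 'rV[R]_n -> \bar R)
    (x : 'rV[R]_n) : 'rV[R]_n :=
  \row_i 'd (fun y => fine (f y)) x (delta_mx ord0 i).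

(* Vectors are rows, so the product A u of the paper is [u *m A^T]. *)
Definition mxapp (R : realType) (n : nat) (A : 'M[R]_n) (u : 'rV[R]_n) :
  'rV[R]_n := u *m A^T.

Definition is_ext_hessian (R : realType) (n : nat) (f : 'rV[R]_n -> \bar R)
    (xb : 'rV[R]_n) (A : 'M[R]_n) : Prop :=
  exists U D : set 'rV[R]_n,
    [/\ nbhs xb U,
        D `<=` U /\ lebesgue_outer (U `\` D) = 0%E,
        (forall x, U x -> f x \is a fin_num) /\
          [lipschitz fine (f x) | x in U],
        (forall x, D x -> ediff f x) &
        (enorm (x - xb))^-1 *: (grad f x - grad f xb - mxapp A (x - xb))
          @[x --> within D xb^'] --> (0 : 'rV[R]_n)].

Definition ext_twice_differentiable (R : realType) (n : nat)
    (f : 'rV[R]_n -> \bar R) (xb : 'rV[R]_n) : Prop :=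
  [/\ f xb \is a fin_num, ediff f xb & exists A, is_ext_hessian f xb A].

(* [A] is unique: U `\` D is null, so D is dense near xb. *)
Definition hessian (R : realType) (n : nat) (f : 'rV[R]_n -> \bar R)
    (xb : 'rV[R]_n) : 'M[R]_n :=
  xget 0 [set A | is_ext_hessian f xb A].

Definition frechet_subdiff (R : realType) (n : nat) (f : 'rV[R]_n -> \bar R)
    (xb : 'rV[R]_n) : set 'rV[R]_n :=
  [set v | (f xb < +oo)%E /\
    (0 <= limf_einf (fun x : 'rV[R]_n => (f x - f xb - (dot v (x - xb)%R)%:E)
                          * ((enorm (x - xb)%R)^-1)%:E) xb^')%E].

Definition limiting_subdiff (R : realType) (n : nat) (f : 'rV[R]_n -> \bar R)
    (xb : 'rV[R]_n) : set 'rV[R]_n :=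
  [set v | (f xb < +oo)%E /\
    exists x_ v_ : nat -> 'rV[R]_n,
      [/\ x_ k @[k --> \oo] --> xb,
          f (x_ k) @[k --> \oo] --> f xb,
          v_ k @[k --> \oo] --> v &
          forall k, frechet_subdiff f (x_ k) (v_ k)]].

Definition subderivative (R : realType) (n : nat) (f : 'rV[R]_n -> \bar R)
    (xb w : 'rV[R]_n) : \bar R :=
  limf_einf (fun p : R * 'rV[R]_n =>
      (f (xb + p.1 *: p.2)%R - f xb) * (p.1^-1)%:E)%E
    (filter_prod 0^'+ (nbhs w)).

Definition second_subderivative (R : realType) (n : nat)
    (f : 'rV[R]_n -> \bar R) (xb v w : 'rV[R]_n) : \bar R :=
  limf_einf (fun p : R * 'rV[R]_n =>
      (f (xb + p.1 *: p.2)%R - f xb - (p.1 * dot v p.2)%:E)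
        * ((2^-1 * p.1 ^+ 2)^-1)%:E)%E
    (filter_prod 0^'+ (nbhs w)).

(* Meaningful only when [subderivative f xb w] is finite. *)
Definition parabolic_subderivative (R : realType) (n : nat)
    (f : 'rV[R]_n -> \bar R) (xb w z : 'rV[R]_n) : \bar R :=
  limf_einf (fun p : R * 'rV[R]_n =>
      (f (xb + p.1 *: w + (2^-1 * p.1 ^+ 2) *: p.2)%R - f xb
         - p.1%:E * subderivative f xb w)
        * ((2^-1 * p.1 ^+ 2)^-1)%:E)%E
    (filter_prod 0^'+ (nbhs z)).

(* Empty when x is not in Omega. *)
Definition tangent_cone (R : realType) (V : normedModType R) (Omega : set V)
    (x : V) : set V :=
  [set v | Omega x /\
    exists (t_ : nat -> R) (v_ : nat -> V),
      [/\ forall k, 0 < t_ k,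
          t_ k @[k --> \oo] --> (0 : R),
          v_ k @[k --> \oo] --> v &
          forall k, Omega (x + t_ k *: v_ k)]].

Definition graph_of (S T : Type) (F : S -> set T) : set (S * T) :=
  [set p | F p.1 p.2].

Definition graphical_derivative (R : realType) (n : nat)
    (F : 'rV[R]_n -> set 'rV[R]_n) (xb vb w : 'rV[R]_n) : set 'rV[R]_n :=
  [set z | tangent_cone (graph_of F) (xb, vb) (w, z)].

(* Main.v *)
(* Since [phi] is Lipschitz near [xb], a bound on its partial derivatives off a
   null set bounds its increments along the axes.  Applied to [phi] minus a
   primitive of the quadratic model, this shows that the extended Hessian [A] is
   symmetric (compare the increments along the two sides of a small square) and
   that [phi] minus its second order expansion at [xb] is Lipschitz with constant
   [o(1) * max (|x - xb|, |y - xb|)].  The two formulas for the subderivatives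
   follow by taking [y = xb].  For the graphical derivative, the remainder enters
   a Frechet subgradient inequality of [phi + psi] at [x] as a penalty
   [o(|x - xb|) |y - x|]; replacing it by a smooth penalty and minimising yields a
   Frechet subgradient of [psi] at a nearby point that differs from
   [v - grad phi xb - A (x - xb)] by [o(|x - xb|)], which is invisible to the
   tangent cone.  The reverse inclusion is the same argument for [- phi]. *)
Require Import Defs.
From mathcomp Require Import all_boot all_order all_algebra.
From mathcomp Require Import all_classical all_reals all_analysis.
From mathcomp Require Import ring lra.
Set Implicit Arguments.
Unset Strict Implicit.
Unset Printing Implicit Defensive.
Import Order.TTheory GRing.Theory Num.Theory.
Import numFieldNormedType.Exports.
Local Open Scope classical_set_scope.
Local Open Scope ring_scope.

(** * Boxes, bisection and an axis-parallel flux *)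

(** The obstacle is that a null set may contain a whole segment parallel to an axis, so an increment
    along a given segment cannot be recovered from derivatives on that segment. Lipschitz continuity
    allows the segment to be moved slightly, and some parallel segment in a thin box around it is
    good on average. The average is a Riemann sum of increments over full axis-parallel fibres,
    compared with volumes by a Cousin-type bisection; boxes around points of the null set are paid
    for by a superadditive function of boxes bounded by [eta]. The sup norm is used throughout
    because passing from one point of a ball to another coordinate by coordinate stays in the ball;
    the factor [n + 1] between the norms disappears in statements about all [eps]. The remainder
    must be Lipschitz, not merely of size o(|x - xb|^2), because subgradients are taken at points
    other than [xb], where a bound on values says nothing about slopes. *)

Lemma coord_norm_le (R : realType) (m n : nat) (A : 'M[R]_(m, n))
    (i : 'I_m) (j : 'I_n) : `|A i j| <= `|A|.
Proof.
rewrite {2}/Num.norm/= mx_normrE.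
by apply: (le_bigmax _ (fun ij : 'I_m * 'I_n => `|A ij.1 ij.2|) (i, j)).
Qed.

Lemma norm_le_coord (R : realType) (n : nat) (x : 'rV[R]_n) (r : R) :
  0 <= r -> (forall j, `|x ord0 j| <= r) -> `|x| <= r.
Proof.
move=> r0 H; rewrite {1}/Num.norm/= mx_normrE; apply/bigmax_leP; split => //.
by move=> [i j] _ /=; rewrite ord1.
Qed.

Definition upd (R : realType) (n : nat) (x : 'rV[R]_n) (c : 'I_n) (s : R) :
  'rV[R]_n := \row_j (if j == c then s else x ord0 j).

Lemma updE (R : realType) (n : nat) (x : 'rV[R]_n) (c : 'I_n) (s : R) j :
  upd x c s ord0 j = if j == c then s else x ord0 j.
Proof. by rewrite mxE. Qed.

Lemma upd_same (R : realType) (n : nat) (x : 'rV[R]_n) (c : 'I_n) (s : R) :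
  upd x c s ord0 c = s.
Proof. by rewrite updE eqxx. Qed.

Lemma upd_upd (R : realType) (n : nat) (x : 'rV[R]_n) (c : 'I_n) (s t : R) :
  upd (upd x c s) c t = upd x c t.
Proof. by apply/rowP => j; rewrite !updE; case: eqP. Qed.

Lemma updC (R : realType) (n : nat) (x : 'rV[R]_n) (c d : 'I_n) (s t : R) :
  c != d -> upd (upd x c s) d t = upd (upd x d t) c s.
Proof.
move=> cd; apply/rowP => j; rewrite !updE.
by case: eqP => // ->; case: eqP => // E; rewrite E eqxx in cd.
Qed.

Definition mid (R : realType) (n : nat) (a b : 'rV[R]_n) (c : 'I_n) : R :=
  (a ord0 c + b ord0 c) / 2.

Definition row_le (R : realType) (n : nat) (a b : 'rV[R]_n) : Prop :=
  forall j, a ord0 j <= b ord0 j.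

Lemma row_le_updr (R : realType) (n : nat) (a b : 'rV[R]_n) (c : 'I_n) :
  row_le a b -> row_le a (upd b c (mid a b c)).
Proof.
move=> ab j; rewrite updE; case: eqP => [->|_]; last exact: ab.
by have := ab c; rewrite /mid; lra.
Qed.

Lemma row_le_updl (R : realType) (n : nat) (a b : 'rV[R]_n) (c : 'I_n) :
  row_le a b -> row_le (upd a c (mid a b c)) b.
Proof.
move=> ab j; rewrite updE; case: eqP => [->|_]; last exact: ab.
by have := ab c; rewrite /mid; lra.
Qed.

Lemma row_le_mid_hi (R : realType) (n : nat) (a b : 'rV[R]_n) (c : 'I_n) :
  row_le a b -> row_le (upd b c (mid a b c)) b.
Proof.
move=> ab j; rewrite updE; case: eqP => [->|_] //.
by have := ab c; rewrite /mid; lra.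
Qed.

Lemma row_le_mid_lo (R : realType) (n : nat) (a b : 'rV[R]_n) (c : 'I_n) :
  row_le a b -> row_le a (upd a c (mid a b c)).
Proof.
move=> ab j; rewrite updE; case: eqP => [->|_] //.
by have := ab c; rewrite /mid; lra.
Qed.

Lemma row_le_trans (R : realType) (n : nat) (b a c : 'rV[R]_n) :
  row_le a b -> row_le b c -> row_le a c.
Proof. by move=> ab bc j; exact: le_trans (ab j) (bc j). Qed.

Lemma row_le_refl (R : realType) (n : nat) (a : 'rV[R]_n) : row_le a a.
Proof. by move=> j. Qed.

Definition halved_on (R : realType) (n : nat) (s : seq 'I_n)
    (a b a' b' : 'rV[R]_n) : Prop :=
  [/\ row_le a a', row_le b' b, row_le a' b' &
      forall j, b' ord0 j - a' ord0 j =
        (if j \in s then 2^-1 else 1) * (b ord0 j - a ord0 j)].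

Lemma bisect_round (R : realType) (n : nat)
    (P : seq 'I_n -> 'rV[R]_n -> 'rV[R]_n -> Prop)
    (Pcut : forall c s a b, row_le a b -> P s a (upd b c (mid a b c)) ->
      P s (upd a c (mid a b c)) b -> P (c :: s) a b) s a b :
  uniq s -> row_le a b -> ~ P s a b ->
  exists a' b', halved_on s a b a' b' /\ ~ P [::] a' b'.
Proof.
elim: s a b => [|c s IH] a b /=.
  move=> _ ab nP; exists a, b; split => //; split => // j.
  by rewrite mul1r.
move=> /andP[cs us] ab nP.
have [P1|nP1] := pselect (P s a (upd b c (mid a b c))).
  have nP2 : ~ P s (upd a c (mid a b c)) b by move=> P2; apply/nP/Pcut.
  have [a' [b' [[h1 h2 h3 h4] nP']]] := IH _ _ us (row_le_updl c ab) nP2.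
  exists a', b'; split => //; split => //.
    exact: row_le_trans (row_le_mid_lo c ab) h1.
  move=> j; rewrite h4 in_cons updE.
  have [->|jc] := eqVneq j c; last by [].
  by rewrite (negbTE cs) /= /mid; field.
have [a' [b' [[h1 h2 h3 h4] nP']]] := IH _ _ us (row_le_updr c ab) nP1.
exists a', b'; split => //; split => //.
  exact: row_le_trans h2 (row_le_mid_hi c ab).
move=> j; rewrite h4 in_cons updE.
have [->|jc] := eqVneq j c; last by [].
by rewrite (negbTE cs) /= /mid; field.
Qed.

(** Cousin's lemma. The list in [P] holds the cuts still to be made in the current round. A round
    cuts every coordinate once, so the nested bad boxes are homothetic to the first one, and their
    common point violates [Plocal]. Keeping the shape later makes the diameter of a small box
    comparable with its height. *)
Lemma box_cousin (R : realType) (n : nat)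
    (P : seq 'I_n -> 'rV[R]_n -> 'rV[R]_n -> Prop) (a b : 'rV[R]_n)
    (Pcut : forall c s a b, row_le a b -> P s a (upd b c (mid a b c)) ->
      P s (upd a c (mid a b c)) b -> P (c :: s) a b)
    (Pround : forall a b, P (enum 'I_n) a b -> P [::] a b)
    (Plocal : forall p, box a b p -> exists M, forall m a' b', (M <= m)%N ->
      row_le a a' -> row_le b' b -> box a' b' p ->
      b' - a' = 2^-1 ^+ m *: (b - a) -> P [::] a' b') :
  row_le a b -> P [::] a b.
Proof.
move=> ab; apply: contrapT => nP.
pose bad (Q : 'rV[R]_n * 'rV[R]_n) := row_le Q.1 Q.2 /\ ~ P [::] Q.1 Q.2.
have step (Q : 'rV[R]_n * 'rV[R]_n) : exists Q', bad Q ->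
    bad Q' /\ halved_on (enum 'I_n) Q.1 Q.2 Q'.1 Q'.2.
  have [[Q12 nPQ]|nb] := pselect (bad Q); last by exists Q.
  have nPe : ~ P (enum 'I_n) Q.1 Q.2 by move=> /Pround.
  have [a' [b' [h nP']]] := bisect_round Pcut (enum_uniq _) Q12 nPe.
  by exists (a', b') => _; split => //; split => //; case: h.
have [F HF] := choice step.
pose Q m := iter m F (a, b).
have badQ m : bad (Q m).
  by elim: m => [|m IH] //=; have [] := HF _ IH.
have hQ m : halved_on (enum 'I_n) (Q m).1 (Q m).2 (Q m.+1).1 (Q m.+1).2.
  by have [] := HF _ (badQ m).
have mono m l : (m <= l)%N -> row_le (Q m).1 (Q l).1 /\ row_le (Q l).2 (Q m).2.
  elim: l => [|l IH]; first by rewrite leqn0 => /eqP ->; split; exact: row_le_refl.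
  rewrite leq_eqVlt => /orP[/eqP ->|]; first by split; exact: row_le_refl.
  rewrite ltnS => /IH[h1 h2]; have [h3 h4 _ _] := hQ l.
  by split; [exact: row_le_trans h1 h3|exact: row_le_trans h4 h2].
have cross m l : row_le (Q m).1 (Q l).2.
  have [h1 _] := mono _ _ (leq_maxl m l); have [_ h2] := mono _ _ (leq_maxr m l).
  have [h _] := badQ (maxn m l).
  exact: row_le_trans h1 (row_le_trans h h2).
(* The lower corners increase and stay below every upper corner ([cross]), so their coordinatewise
   supremum lies in all the boxes. *)
pose p : 'rV[R]_n := \row_j sup (range (fun m => (Q m).1 ord0 j)).
have pQ m : box (Q m).1 (Q m).2 p.
  move=> j; rewrite mxE; apply/andP; split.
    apply: ub_le_sup; last by exists m.
    by exists ((Q 0).2 ord0 j) => _ [l _ <-]; exact: cross.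
  apply: ge_sup; first by exists ((Q 0).1 ord0 j), 0%N.
  by move=> _ [l _ <-]; exact: cross.
have wQ m : (Q m).2 - (Q m).1 = 2^-1 ^+ m *: (b - a).
  elim: m => [|m IH]; first by rewrite expr0 scale1r.
  apply/rowP => j; have [_ _ _ /(_ j)] := hQ m.
  rewrite mem_enum inE /= => h.
  rewrite exprS -scalerA -IH !mxE /=.
  by rewrite -[in LHS]/(Q m.+1) -h.
have [M HM] := Plocal p (pQ 0).
have [h1 h2] := mono _ _ (leq0n M).
by have [_ ] := badQ M; apply; exact: (HM M).
Qed.

Definition vol (R : realType) (n : nat) (a b : 'rV[R]_n) : R :=
  \prod_j (b ord0 j - a ord0 j).

Definition base_vol (R : realType) (n : nat) (i : 'I_n) (a b : 'rV[R]_n) : R :=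
  \prod_(j | j != i) (b ord0 j - a ord0 j).

Lemma volE (R : realType) (n : nat) (i : 'I_n) (a b : 'rV[R]_n) :
  vol a b = (b ord0 i - a ord0 i) * base_vol i a b.
Proof. by rewrite /vol (bigD1 i). Qed.

Lemma vol_ge0 (R : realType) (n : nat) (a b : 'rV[R]_n) :
  row_le a b -> 0 <= vol a b.
Proof. by move=> ab; apply: prodr_ge0 => j _; rewrite subr_ge0. Qed.

Lemma base_vol_ge0 (R : realType) (n : nat) (i : 'I_n) (a b : 'rV[R]_n) :
  row_le a b -> 0 <= base_vol i a b.
Proof. by move=> ab; apply: prodr_ge0 => j _; rewrite subr_ge0. Qed.

Lemma base_vol_updr (R : realType) (n : nat) (i : 'I_n) (a b : 'rV[R]_n) s :
  base_vol i a (upd b i s) = base_vol i a b.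
Proof. by apply: eq_bigr => j /negbTE ji; rewrite updE ji. Qed.

Lemma base_vol_updl (R : realType) (n : nat) (i : 'I_n) (a b : 'rV[R]_n) s :
  base_vol i (upd a i s) b = base_vol i a b.
Proof. by apply: eq_bigr => j /negbTE ji; rewrite updE ji. Qed.

Lemma vol_cut (R : realType) (n : nat) (c : 'I_n) (a b : 'rV[R]_n) s :
  vol a (upd b c s) + vol (upd a c s) b = vol a b.
Proof.
by rewrite !(volE c) base_vol_updr base_vol_updl !upd_same; ring.
Qed.

(* A Riemann sum for the integral of the [i]-th partial derivative of [k] over
   the box: the cross-section is refined along the list of cuts, while the
   increment of [k] is always taken over the full height. *)
Fixpoint flux (R : realType) (n : nat) (k : 'rV[R]_n -> R) (i : 'I_n)
    (s : seq 'I_n) (a b : 'rV[R]_n) : R :=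
  if s is c :: s' then
    if c == i then flux k i s' a b
    else flux k i s' a (upd b c (mid a b c)) + flux k i s' (upd a c (mid a b c)) b
  else base_vol i a b * (k (upd a i (b ord0 i)) - k a).

(** At a cut across axis [i] the cross-section is unchanged and the two increments telescope. Hence
    [flux] may skip such cuts and still be additive under every cut, as bisection requires. *)
Lemma flux_cut_axis (R : realType) (n : nat) (k : 'rV[R]_n -> R) (i : 'I_n)
    (s : seq 'I_n) (a b : 'rV[R]_n) (t : R) :
  flux k i s a b = flux k i s a (upd b i t) + flux k i s (upd a i t) b.
Proof.
elim: s a b => [|c s IH] a b /=.
  by rewrite base_vol_updr base_vol_updl upd_same upd_upd; ring.
case: (eqVneq c i) => [_|ci]; first exact: IH.
rewrite (IH a) (IH (upd a c _)).
rewrite /mid !updE (negbTE ci) (updC b _ _ ci) (updC a _ _ ci).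
by rewrite addrACA.
Qed.

Lemma flux_cut (R : realType) (n : nat) (k : 'rV[R]_n -> R) (i c : 'I_n)
    (s : seq 'I_n) (a b : 'rV[R]_n) :
  flux k i (c :: s) a b =
  flux k i s a (upd b c (mid a b c)) + flux k i s (upd a c (mid a b c)) b.
Proof. by rewrite /=; case: eqP => [->|//]; exact: flux_cut_axis. Qed.

Lemma fluxN (R : realType) (n : nat) (k : 'rV[R]_n -> R) (i : 'I_n)
    (s : seq 'I_n) (a b : 'rV[R]_n) :
  flux (fun x => - k x) i s a b = - flux k i s a b.
Proof.
elim: s a b => [|c s IH] a b /=; first by ring.
by case: ifP => _; rewrite !IH // opprD.
Qed.

Lemma flux_le (R : realType) (n : nat) (k : 'rV[R]_n -> R) (i : 'I_n)
    (s : seq 'I_n) (a b : 'rV[R]_n) (M : R) :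
  row_le a b ->
  (forall x, box a b x -> x ord0 i = a ord0 i ->
     k (upd x i (b ord0 i)) - k x <= M * (b ord0 i - a ord0 i)) ->
  flux k i s a b <= M * vol a b.
Proof.
elim: s a b => [|c s IH] a b ab H /=.
  rewrite (volE i) mulrA [leRHS]mulrC ler_wpM2l ?base_vol_ge0 //.
  by apply: H => // j; rewrite lexx ab.
case: (eqVneq c i) => [_|ci]; first exact: IH.
rewrite -(vol_cut c a b (mid a b c)) mulrDr.
have ic : (i == c) = false by rewrite eq_sym; apply/negbTE.
apply: lerD; apply: IH.
- exact: row_le_updr.
- move=> x bx xi; rewrite updE ic; apply: H => // j.
  have /andP[-> /le_trans h] := bx j; exact/h/row_le_mid_hi.
- exact: row_le_updl.
- move=> x bx; rewrite updE ic; apply: H => // j.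
  have /andP[/(le_trans _) h ->] := bx j; rewrite andbT; exact/h/row_le_mid_lo.
Qed.

(** * Null sets and increments along an axis *)

(** Enlarging gives every point of a covering box a margin, so that small boxes around the point
    stay inside. The volume is continuous in the margin [d], even for empty boxes, thanks to the
    truncation at 0. *)
Lemma box_enlarge (R : realType) (n : nat) (a b : 'rV[R]_n) (e : R) : 0 < e ->
  exists d, 0 < d /\
    \prod_j Num.max 0 ((b ord0 j + d) - (a ord0 j - d)) <= box_volume a b + e.
Proof.
move=> e0.
have cts (r : seq 'I_n) : (fun d : R => \prod_(j <- r)
    Num.max 0 ((b ord0 j + d) - (a ord0 j - d))) d @[d --> (0 : R)] -->
    \prod_(j <- r) Num.max 0 (b ord0 j - a ord0 j).
  elim: r => [|j r IH].
    under eq_fun do rewrite big_nil; rewrite big_nil; exact: cvg_cst.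
  under eq_fun do rewrite big_cons; rewrite big_cons; apply: cvgM => //.
  have h : (fun d : R => (b ord0 j + d) - (a ord0 j - d)) d @[d --> (0 : R)] -->
      b ord0 j - a ord0 j.
    rewrite -[X in _ --> X - _]addr0 -[X in _ --> _ - X]subr0.
    by apply: cvgB; [apply: cvgD|apply: cvgB] => //; try exact: cvg_cst; exact: cvg_id.
  apply: (@cvg_comp _ _ _ _ (fun y : R => Num.max 0 y) _ _ _ h).
  by apply: (@continuous_max _ R (fun=> 0) id); [exact: cvg_cst|exact: cvg_id].
have : \forall d \near (0 : R), \prod_j
    Num.max 0 ((b ord0 j + d) - (a ord0 j - d)) <= box_volume a b + e.
  apply: (cvgr_le _ (cts (index_enum 'I_n))).
  by rewrite /box_volume ltrDl.
move=> /nbhs_ballP[r /= r0 hr]; exists (r / 2); split; first by lra.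
by apply: hr; rewrite /ball/= sub0r normrN ger0_norm; lra.
Qed.

(** The volume of the intersection of the boxes [[A, B]] and [[a, b]]; an empty intersection shows
    up as a factor 0. *)
Definition inter_vol (R : realType) (n : nat) (A B a b : 'rV[R]_n) : R :=
  \prod_j Num.max 0
    (Num.min (b ord0 j) (B ord0 j) - Num.max (a ord0 j) (A ord0 j)).

Lemma inter_vol_ge0 (R : realType) (n : nat) (A B a b : 'rV[R]_n) :
  0 <= inter_vol A B a b.
Proof. by apply: prodr_ge0 => j _; rewrite le_max lexx. Qed.

Lemma inter_vol_le (R : realType) (n : nat) (A B a b : 'rV[R]_n) :
  inter_vol A B a b <= \prod_j Num.max 0 (B ord0 j - A ord0 j).
Proof.
apply: ler_prod => j _; rewrite le_max lexx /=.
by rewrite ge_max le_max lexx /= le_max lerB ?orbT // ?ge_min ?le_max lexx orbT.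
Qed.

Lemma inter_vol_sub (R : realType) (n : nat) (A B a b : 'rV[R]_n) :
  row_le a b -> row_le A a -> row_le b B -> inter_vol A B a b = vol a b.
Proof.
move=> ab Aa bB; apply: eq_bigr => j _.
by rewrite (min_idPl (bB j)) (max_idPl (Aa j)); apply/max_idPr; rewrite subr_ge0.
Qed.

Lemma max0_superadd (R : realType) (p q r : R) :
  p <= r -> q <= r -> p + q <= r ->
  Num.max 0 p + Num.max 0 q <= Num.max 0 r.
Proof. by case: (leP 0 p); case: (leP 0 q); case: (leP 0 r) => *; lra. Qed.

Lemma inter_vol_cut (R : realType) (n : nat) (A B a b : 'rV[R]_n) c :
  row_le a b ->
  inter_vol A B a (upd b c (mid a b c)) + inter_vol A B (upd a c (mid a b c)) b
    <= inter_vol A B a b.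
Proof.
move=> ab; rewrite /inter_vol (bigD1 c) //= [X in _ + X <= _](bigD1 c) //=.
rewrite [leRHS](bigD1 c) //= !upd_same.
set p := (X in _ * X + _ <= _); set q := (X in _ + _ * X <= _).
set r := (X in _ <= _ * X).
have -> : p = r by apply: eq_bigr => j /negbTE jc; rewrite !updE jc.
have -> : q = r by apply: eq_bigr => j /negbTE jc; rewrite !updE jc.
rewrite -mulrDl; apply: ler_wpM2r.
  by apply: prodr_ge0 => j _; rewrite le_max lexx.
have := ab c; rewrite /mid => abc; set m := (_ / 2).
have am : a ord0 c <= m by rewrite /m; lra.
have mb : m <= b ord0 c by rewrite /m; lra.
move: (a ord0 c) (b ord0 c) m (A ord0 c) (B ord0 c) am mb {ab abc p q r}.
move=> x y m X Y xm my; apply: max0_superadd.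
- by rewrite lerB // le_min !ge_min my lexx orbT.
- by rewrite lerB // ge_max !le_max xm lexx orbT.
- have : Num.min m Y <= Num.max m X by rewrite ge_min le_max lexx.
  by lra.
Qed.

(** [nu a b] adds up the volumes of the intersections of [[a, b]] with slightly enlarged boxes of a
    cover of [N]. The cover takes half of [eta] and the enlargements the other half, the [k]-th one
    [(eta / 2) / 2 ^ k.+1]. A box that contains a point of the [k]-th covering box and is smaller
    than its margin lies in the enlargement, which gives the last clause. *)
Lemma null_gauge (R : realType) (n : nat) (N : set 'rV[R]_n) (eta : R) :
  0 < eta -> lebesgue_outer N = 0%E ->
  exists nu : 'rV[R]_n -> 'rV[R]_n -> R,
    [/\ forall a b, 0 <= nu a b <= eta,
        forall a b c, row_le a b ->
          nu a (upd b c (mid a b c)) + nu (upd a c (mid a b c)) b <= nu a b &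
        forall p, N p -> exists2 d, 0 < d & forall a b, row_le a b ->
          box a b p -> `|b - a| <= d -> vol a b <= nu a b].
Proof.
move=> eta0 N0.
have e2 : 0 < eta / 2 by lra.
have : (lebesgue_outer N < (eta / 2)%:E)%E by rewrite N0 lte_fin.
move=> /ereal_inf_lt[_ [I [A [B [NAB ->]]]] sAB].
have dP k : exists d, 0 < d /\ \prod_j Num.max 0
    ((B k ord0 j + d) - (A k ord0 j - d)) <=
    box_volume (A k) (B k) + (eta / 2) / (2 ^ k.+1)%:R.
  by apply: box_enlarge; rewrite divr_gt0 // ltr0n expn_gt0.
have [d Hd] := choice dP.
pose A' k : 'rV[R]_n := \row_j (A k ord0 j - d k).
pose B' k : 'rV[R]_n := \row_j (B k ord0 j + d k).
pose S a b : \bar R := (\esum_(k in I) (inter_vol (A' k) (B' k) a b)%:E)%E.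
have S0 a b : (0 <= S a b)%E.
  by apply: esum_ge0 => k _; rewrite lee_fin inter_vol_ge0.
have Sle a b : (S a b <= eta%:E)%E.
  apply: (@le_trans _ _ (\esum_(k in I) ((box_volume (A k) (B k))%:E +
      ((eta / 2) / (2 ^ k.+1)%:R)%:E))%E).
    apply: le_esum => k _; rewrite -EFinD lee_fin.
    apply: le_trans (inter_vol_le _ _ _ _) _; have [_] := Hd k.
    by under [X in _ -> X <= _]eq_bigr do rewrite !mxE.
  rewrite esumD; last 2 first.
  - move=> k _; rewrite lee_fin; apply: prodr_ge0 => j _; by rewrite le_max lexx.
  - by move=> k _; rewrite lee_fin divr_ge0 // ltW.
  rewrite [in leRHS](splitr eta) EFinD; apply: leeD; first exact: ltW.
  apply: le_trans (epsilon_trick0 xpredT (ltW e2)).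
  rewrite nneseries_esumT; last by move=> k; rewrite lee_fin divr_ge0 // ltW.
  rewrite esum_mkcond; apply: le_esum => k _; case: ifP => // _.
  by rewrite lee_fin divr_ge0 // ltW.
have Sfin a b : S a b \is a fin_num.
  by rewrite ge0_fin_numE //; apply: le_lt_trans (Sle a b) (ltry _).
exists (fun a b => fine (S a b)); split.
- move=> a b; rewrite fine_ge0 //=.
  by rewrite -lee_fin fineK.
- move=> a b c ab; rewrite -lee_fin EFinD !fineK //.
  rewrite -esumD; try by move=> k _; rewrite lee_fin inter_vol_ge0.
  by apply: le_esum => k _; rewrite -EFinD lee_fin inter_vol_cut.
- move=> p /NAB[k Ik pk]; have [dk _] := Hd k; exists (d k) => // a b ab pab bad.
  rewrite -lee_fin fineK //.
  have w j : b ord0 j - a ord0 j <= d k.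
    have := coord_norm_le (b - a) ord0 j; rewrite !mxE => /le_trans/(_ bad).
    exact: le_trans (ler_norm _).
  have -> : vol a b = inter_vol (A' k) (B' k) a b.
    rewrite inter_vol_sub // => j; rewrite mxE.
      by have := pab j; have := pk j; have := w j; lra.
    by have := pab j; have := pk j; have := w j; lra.
  apply: esum_ge; exists [set k]; last by rewrite fsbig_set1.
  by split => // _ ->.
Qed.

Lemma box_diam (R : realType) (n : nat) (a b x y : 'rV[R]_n) :
  box a b x -> box a b y -> `|x - y| <= `|b - a|.
Proof.
move=> xab yab; apply: norm_le_coord => // j.
apply: le_trans (coord_norm_le (b - a) ord0 j); rewrite !mxE.
have := xab j; have := yab j => h1 h2.
rewrite [leRHS]ger0_norm; last by lra.
by rewrite ler_norml; lra.
Qed.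

Lemma half_pow_small (R : realType) (C d : R) : 0 <= C -> 0 < d ->
  exists M, forall m, (M <= m)%N -> 2^-1 ^+ m * C <= d.
Proof.
move=> C0 d0.
have h : (fun m => 2^-1 ^+ m * C) m @[m --> \oo] --> (0 : R).
  rewrite -(mul0r C); apply: cvgMr_tmp; apply: cvg_expr.
  by rewrite ger0_norm; lra.
have [M _ HM] := cvgr_le _ h d d0.
by exists M => m /HM.
Qed.

(** An upper bound for the [i]-th partial derivative at [p], tested on segments near [p] that need
    not pass through [p]: in a small box around [p] most fibres of [flux] miss [p]. *)
Definition axis_deriv_le (R : realType) (n : nat) (k : 'rV[R]_n -> R)
    (i : 'I_n) (eps : R) (p : 'rV[R]_n) : Prop :=
  forall tau, 0 < tau -> exists2 d, 0 < d & forall x s, `|x - p| <= d ->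
    `|upd x i s - p| <= d -> x ord0 i <= s ->
    k (upd x i s) - k x <=
      eps * (s - x ord0 i) + tau * (`|x - p| + `|upd x i s - p|).

(** If all fibres were steeper, the flux would be at least [(eps + tau) * vol a b], whereas
    bisection bounds it by [(eps + tau / 2) * vol a b] plus [L] times the gauge of the null set. *)
Lemma ae_axis_ex (R : realType) (n : nat) (k : 'rV[R]_n -> R) (i : 'I_n)
    (a b : 'rV[R]_n) (N : set 'rV[R]_n) (eps tau L : R) :
  (forall j, a ord0 j < b ord0 j) -> 0 <= eps -> 0 < tau -> 0 <= L ->
  (forall x y, box a b x -> box a b y -> `|k x - k y| <= L * `|x - y|) ->
  lebesgue_outer N = 0%E ->
  (forall p, box a b p -> ~ N p -> axis_deriv_le k i eps p) ->
  exists x, [/\ box a b x, x ord0 i = a ord0 i &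
    k (upd x i (b ord0 i)) - k x <= (eps + tau) * (b ord0 i - a ord0 i)].
Proof.
move=> ab eps0 tau0 L0 lip N0 H; apply: contrapT => nex.
have inc x : box a b x -> x ord0 i = a ord0 i ->
    (eps + tau) * (b ord0 i - a ord0 i) < k (upd x i (b ord0 i)) - k x.
  by move=> bx xi; rewrite ltNge; apply/negP => le; apply: nex; exists x.
have lab : row_le a b by move=> j; exact: ltW.
have V0 : 0 < vol a b by apply: prodr_gt0 => j _; rewrite subr_gt0.
have L1 : 0 < 4 * (L + 1) by lra.
(* This makes [L * eta] at most [tau * vol a b / 4], below the gap [tau * vol a b / 2]; [L + 1]
   avoids a division by zero. *)
pose eta := tau * vol a b / (4 * (L + 1)).
have eta0 : 0 < eta by rewrite divr_gt0 // mulr_gt0.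
have [nu [nub nucut nuloc]] := null_gauge eta0 N0.
pose rep J := flatten (nseq J (enum 'I_n)).
(* The bound is asked for all large numbers [J] of further rounds, so that the two halves of a cut
   can share one [J]; a completed round turns [enum 'I_n ++ rep J] into [rep J.+1]. *)
pose P s a' b' := row_le a a' -> row_le b' b -> exists J0, forall J,
  (J0 <= J)%N ->
  flux k i (s ++ rep J) a' b' <= (eps + tau / 2) * vol a' b' + L * nu a' b'.
have hi0 : 0 < b ord0 i - a ord0 i by rewrite subr_gt0.
have {}inc J : (eps + tau) * vol a b <= flux k i (rep J) a b.
  rewrite -lerN2 -fluxN -mulNr; apply: flux_le => // x bx xi.
  by have := inc _ bx xi; rewrite mulNr; lra.
suff : P [::] a b.
  move=> /(_ (row_le_refl a) (row_le_refl b))[J0 /(_ J0 (leqnn _))] /=.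
  have /andP[nu0 nue] := nub a b.
  have : L * nu a b <= L * eta by rewrite ler_wpM2l.
  have : L * eta <= tau * vol a b / 4.
    rewrite /eta mulrA ler_pdivrMr // -subr_ge0.
    rewrite [X in 0 <= X](_ : _ = tau * vol a b); first by rewrite mulr_ge0 ?ltW.
    by field.
  have := inc J0; have : 0 < tau * vol a b by rewrite mulr_gt0.
  rewrite !mulrDl; lra.
apply: (@box_cousin _ _ P) => //.
- move=> c s a' b' ab' P1 P2 aa' bb'.
  have [J1 h1] := P1 aa' (row_le_trans (row_le_mid_hi c ab') bb').
  have [J2 h2] := P2 (row_le_trans aa' (row_le_mid_lo c ab')) bb'.
  exists (maxn J1 J2) => J; rewrite geq_max => /andP[/h1 {}h1 /h2 {}h2].
  rewrite cat_cons flux_cut -(vol_cut c a' b' (mid a' b' c)).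
  apply: le_trans (lerD h1 h2) _.
  have : L * (nu a' (upd b' c (mid a' b' c)) + nu (upd a' c (mid a' b' c)) b')
      <= L * nu a' b' by rewrite ler_wpM2l // nucut.
  lra.
- move=> a' b' Pe aa' bb'; have [J0 HJ] := Pe aa' bb'.
  by exists J0.+1 => -[//|J]; rewrite ltnS => /HJ.
move=> p pab.
have Lbox a' b' s : row_le a a' -> row_le b' b -> row_le a' b' ->
    flux k i s a' b' <= L * vol a' b'.
  move=> aa' bb' ab'; apply: flux_le => // x bx xi.
  have bx' : box a b x.
    move=> j; have /andP[h1 h2] := bx j.
    by rewrite (le_trans (aa' j) h1) (le_trans h2 (bb' j)).
  apply: le_trans (ler_norm _) _; apply: le_trans (lip _ _ _ bx') _.
    move=> j; rewrite updE; case: eqP => [->|_]; last exact: bx'.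
    by rewrite bb' (le_trans (aa' i) (ab' i)).
  rewrite ler_wpM2l //; apply: norm_le_coord; first by rewrite subr_ge0.
  move=> j; rewrite !mxE; case: eqP => [->|_].
    by rewrite xi ger0_norm // subr_ge0.
  by rewrite subrr normr0 subr_ge0.
have sc m (a' b' : 'rV[R]_n) : b' - a' = 2^-1 ^+ m *: (b - a) ->
    `|b' - a'| = 2^-1 ^+ m * `|b - a|.
  by move=> ->; rewrite normrZ ger0_norm // exprn_ge0 // invr_ge0.
have sci m (a' b' : 'rV[R]_n) : b' - a' = 2^-1 ^+ m *: (b - a) ->
    b' ord0 i - a' ord0 i = 2^-1 ^+ m * (b ord0 i - a ord0 i).
  by move=> /rowP/(_ i); rewrite !mxE.
(* At a point of [N] only the Lipschitz bound is available, but there the gauge dominates the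
   volume. Elsewhere the derivative bound suffices. *)
have [Np|Np] := pselect (N p).
  have [d d0 hd] := nuloc _ Np.
  have [M HM] := half_pow_small (normr_ge0 (b - a)) d0.
  exists M => m a' b' Mm aa' bb' pab' dab _ _; exists 0%N => J _ /=.
  have ab' : row_le a' b'.
    by move=> j; have /andP[] := pab' j; exact: le_trans.
  apply: le_trans (Lbox _ _ _ aa' bb' ab') _.
  have : L * vol a' b' <= L * nu a' b'.
    by rewrite ler_wpM2l // hd // (sc _ _ _ dab) HM.
  have : 0 <= (eps + tau / 2) * vol a' b'.
    by rewrite mulr_ge0 ?vol_ge0 //; lra.
  lra.
(* The derivative error on a sub-box is at most 2 tau' |b' - a'|. As sub-boxes keep the proportions
   of the first box, this choice makes it at most tau / 2 times their height. *)
pose tau' := tau / 4 * (b ord0 i - a ord0 i) / (`|b - a| + 1).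
have ba0 := normr_ge0 (b - a).
have ba1 : 0 < `|b - a| + 1 by lra.
have tau'0 : 0 < tau' by rewrite divr_gt0 // mulr_gt0 // divr_gt0.
have [d d0 hd] := H p pab Np _ tau'0.
have [M HM] := half_pow_small ba0 d0.
exists M => m a' b' Mm aa' bb' pab' dab _ _; exists 0%N => J _ /=.
have ab' : row_le a' b'.
  by move=> j; have /andP[] := pab' j; exact: le_trans.
have nu0 : 0 <= L * nu a' b' by have /andP[? _] := nub a' b'; rewrite mulr_ge0.
suff : flux k i (rep J) a' b' <= (eps + tau / 2) * vol a' b' by lra.
apply: flux_le => // x bx xi.
have bux : box a' b' (upd x i (b' ord0 i)).
  move=> j; rewrite updE; case: eqP => [->|_]; last exact: bx.
  by rewrite lexx ab'.
have dx := box_diam bx pab'; have dux := box_diam bux pab'.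
have dd : `|b' - a'| <= d by rewrite (sc _ _ _ dab) HM.
have := hd x (b' ord0 i) (le_trans dx dd) (le_trans dux dd).
rewrite xi => /(_ (ab' i)) /le_trans; apply.
rewrite mulrDl lerD2l.
apply: (@le_trans _ _ (tau' * (`|b' - a'| + `|b' - a'|))).
  by rewrite ler_wpM2l ?lerD // ltW.
rewrite (sc _ _ _ dab) (sci _ _ _ dab) /tau'.
set q := 2^-1 ^+ m; have q0 : 0 <= q by rewrite exprn_ge0 // invr_ge0.
set D := `|b - a| in ba0 ba1 *; set h := b ord0 i - a ord0 i in hi0 *.
rewrite [leLHS](_ : _ = (q * (tau / 2 * h)) * (D / (D + 1))); last first.
  by field; rewrite gt_eqF.
rewrite [leRHS](_ : _ = q * (tau / 2 * h) * 1); last by ring.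
apply: ler_wpM2l; first by rewrite mulr_ge0 // mulr_ge0 ?ltW // divr_gt0.
by rewrite ler_pdivrMr //; lra.
Qed.

(** A good fibre in a thin box around the segment from [x] to [upd x i s] is within [e] of it, so
    replacing one by the other changes the increment by at most [2 * L * e <= tau / 2]. The other
    half of [tau] is the slope error [tau / (2 * h)] over the length [h]. The margin [d] keeps the
    thin box inside [box a b]. *)
Lemma ae_axis_le (R : realType) (n : nat) (k : 'rV[R]_n -> R) (i : 'I_n)
    (a b : 'rV[R]_n) (N : set 'rV[R]_n) (eps L : R) :
  0 <= eps -> 0 <= L ->
  (forall x y, box a b x -> box a b y -> `|k x - k y| <= L * `|x - y|) ->
  lebesgue_outer N = 0%E ->
  (forall p, box a b p -> ~ N p -> axis_deriv_le k i eps p) ->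
  forall (x : 'rV[R]_n) (s d : R), 0 < d ->
    (forall j, a ord0 j <= x ord0 j - d /\ x ord0 j + d <= b ord0 j) ->
    x ord0 i <= s -> s <= b ord0 i ->
    k (upd x i s) - k x <= eps * (s - x ord0 i).
Proof.
move=> eps0 L0 lip N0 H x s d d0 xd xs sb.
have [<-|xsn] := eqVneq (x ord0 i) s.
  rewrite (_ : upd _ _ _ = x) ?subrr ?mulr0 //.
  by apply/rowP => j; rewrite updE; case: eqP => // ->.
have {xsn}xs : x ord0 i < s by rewrite lt_neqAle xsn.
apply/ler_addgt0Pr => tau tau0.
set h := s - x ord0 i; have h0 : 0 < h by rewrite subr_gt0.
pose e := Num.min d (tau / (4 * (L + 1))).
have L1 : 0 < 4 * (L + 1) by lra.
have e0 : 0 < e by rewrite lt_min d0 divr_gt0.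
have ed : e <= d by rewrite ge_min lexx.
have et : L * e <= tau / 4.
  apply: (@le_trans _ _ (L * (tau / (4 * (L + 1))))).
    by rewrite ler_wpM2l // ge_min lexx orbT.
  rewrite mulrA ler_pdivrMr //.
  rewrite -subr_ge0 [X in 0 <= X](_ : _ = tau) ?ltW //; by field.
pose a' : 'rV[R]_n := \row_j (if j == i then x ord0 i else x ord0 j - e).
pose b' : 'rV[R]_n := \row_j (if j == i then s else x ord0 j + e).
have bb y : box a' b' y -> box a b y.
  move=> by' j; have [h1 h2] := xd j; have := by' j; rewrite !mxE.
  case: eqP => [ji|_]; last by lra.
  by rewrite ji in h1 h2 *; lra.
have [||||x' [bx' x'i]] := @ae_axis_ex R n k i a' b' N eps (tau / (2 * h)) L _
    eps0 _ L0 _ N0.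
- by move=> j; rewrite !mxE; case: eqP => // _; lra.
- by rewrite divr_gt0 // mulr_gt0.
- by move=> y z /bb yb /bb zb; apply: lip.
- by move=> p /bb; exact: H.
rewrite /a' /b' !mxE eqxx -/h => x'le.
have xx' : `|x - x'| <= e.
  apply: norm_le_coord; first exact: ltW.
  move=> j; rewrite !mxE; have := bx' j; rewrite !mxE.
  case: eqP => [ji|_] hx; last by rewrite ler_norml; lra.
  by move: x'i; rewrite mxE eqxx ji => ->; rewrite subrr normr0 ltW.
have uu' : `|upd x i s - upd x' i s| <= e.
  apply: norm_le_coord; first exact: ltW.
  move=> j; rewrite !mxE; case: eqP => ji; first by rewrite subrr normr0 ltW.
  have := bx' j; rewrite !mxE; move/eqP/negbTE: ji => -> ?.
  by rewrite ler_norml; lra.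
have bx : box a b x by move=> j; have [] := xd j; lra.
have bu y : box a b y -> box a b (upd y i s).
  move=> yb j; rewrite updE; case: eqP => [->|_]; last exact: yb.
  by have [] := xd i; lra.
have l1 := le_trans (lip _ _ bx (bb _ bx')) (ler_wpM2l L0 xx').
have l2 := le_trans (lip _ _ (bu _ bx) (bu _ (bb _ bx'))) (ler_wpM2l L0 uu').
have th : tau / (2 * h) * h = tau / 2 by field; rewrite gt_eqF.
move: x'le l1 l2; rewrite mulrDl th !ler_norml; lra.
Qed.

(** * The second order expansion *)

Lemma dotC (R : realType) (n : nat) (u v : 'rV[R]_n) : dot u v = dot v u.
Proof. by apply: eq_bigr => i _; rewrite mulrC. Qed.

Lemma dotDr (R : realType) (n : nat) (u v w : 'rV[R]_n) :
  dot u (v + w) = dot u v + dot u w.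
Proof. by rewrite /dot -big_split; apply: eq_bigr => i _; rewrite mxE mulrDr. Qed.

Lemma dotZr (R : realType) (n : nat) (a : R) (u v : 'rV[R]_n) :
  dot u (a *: v) = a * dot u v.
Proof. by rewrite /dot mulr_sumr; apply: eq_bigr => i _; rewrite mxE; ring. Qed.

Lemma dotNr (R : realType) (n : nat) (u v : 'rV[R]_n) : dot u (- v) = - dot u v.
Proof. by rewrite -scaleN1r dotZr mulN1r. Qed.

Lemma dotDl (R : realType) (n : nat) (u v w : 'rV[R]_n) :
  dot (v + w) u = dot v u + dot w u.
Proof. by rewrite dotC dotDr !(dotC u). Qed.

Lemma dotZl (R : realType) (n : nat) (a : R) (u v : 'rV[R]_n) :
  dot (a *: v) u = a * dot v u.
Proof. by rewrite dotC dotZr dotC. Qed.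

Lemma dotNl (R : realType) (n : nat) (u v : 'rV[R]_n) : dot (- u) v = - dot u v.
Proof. by rewrite dotC dotNr dotC. Qed.

Lemma dot0r (R : realType) (n : nat) (u : 'rV[R]_n) : dot u 0 = 0.
Proof. by rewrite -(scale0r u) dotZr mul0r. Qed.

Lemma dot_delta (R : realType) (n : nat) (u : 'rV[R]_n) (i : 'I_n) :
  dot u (delta_mx ord0 i) = u ord0 i.
Proof.
rewrite /dot (bigD1 i) //= big1 => [|j /negbTE ji].
  by rewrite mxE !eqxx mulr1 addr0.
by rewrite mxE ji andbF mulr0.
Qed.

Lemma dot_le (R : realType) (n : nat) (u v : 'rV[R]_n) :
  `|dot u v| <= n%:R * `|u| * `|v|.
Proof.
apply: le_trans (ler_norm_sum _ _ _) _.
rewrite -mulrA mulr_natl -[X in _ *+ X](card_ord n) -sumr_const.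
by apply: ler_sum => j _; rewrite normrM ler_pM // coord_norm_le.
Qed.

Lemma norm_sqr_le_dot (R : realType) (n : nat) (u : 'rV[R]_n) :
  `|u| ^+ 2 <= dot u u.
Proof.
have d0 : 0 <= dot u u by apply: sumr_ge0 => j _; rewrite -expr2 sqr_ge0.
rewrite -(sqr_sqrtr d0) lerXn2r ?nnegrE ?sqrtr_ge0 //.
apply: norm_le_coord; rewrite ?sqrtr_ge0 // => j.
rewrite -sqrtr_sqr ler_wsqrtr // /dot (bigD1 j) //= expr2 lerDl.
by apply: sumr_ge0 => l _; rewrite -expr2 sqr_ge0.
Qed.

Lemma norm_le_enorm (R : realType) (n : nat) (u : 'rV[R]_n) : `|u| <= enorm u.
Proof.
rewrite -(ger0_norm (normr_ge0 u)) -sqrtr_sqr ler_wsqrtr //.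
exact: norm_sqr_le_dot.
Qed.

Lemma enorm_le (R : realType) (n : nat) (u : 'rV[R]_n) :
  enorm u <= (n%:R + 1) * `|u|.
Proof.
have n0 : 0 <= n%:R :> R by [].
have p0 : 0 <= (n%:R + 1) * `|u| by rewrite mulr_ge0 // addr_ge0.
rewrite -(ger0_norm p0) -sqrtr_sqr ler_wsqrtr //.
apply: le_trans (ler_norm _) _; apply: le_trans (dot_le u u) _.
rewrite exprMn -mulrA -expr2 ler_wpM2r ?sqr_ge0 //.
by rewrite sqrrD; nra.
Qed.

Lemma mxappD (R : realType) (n : nat) (A : 'M[R]_n) (u v : 'rV[R]_n) :
  mxapp A (u + v) = mxapp A u + mxapp A v.
Proof. exact: mulmxDl. Qed.

Lemma mxappZ (R : realType) (n : nat) (A : 'M[R]_n) (a : R) (u : 'rV[R]_n) :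
  mxapp A (a *: u) = a *: mxapp A u.
Proof. by rewrite /mxapp scalemxAl. Qed.

Lemma mxappN (R : realType) (n : nat) (A : 'M[R]_n) (u : 'rV[R]_n) :
  mxapp A (- u) = - mxapp A u.
Proof. exact: mulNmx. Qed.

Lemma mxapp0 (R : realType) (n : nat) (A : 'M[R]_n) : mxapp A 0 = 0.
Proof. exact: mul0mx. Qed.

Lemma mxappNl (R : realType) (n : nat) (A : 'M[R]_n) (u : 'rV[R]_n) :
  mxapp (- A) u = - mxapp A u.
Proof. by rewrite /mxapp linearN /= mulmxN. Qed.

Lemma mxappE (R : realType) (n : nat) (A : 'M[R]_n) (u : 'rV[R]_n) i :
  mxapp A u ord0 i = \sum_j u ord0 j * A i j.
Proof. by rewrite mxE; apply: eq_bigr => j _; rewrite mxE. Qed.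

Lemma mxapp_delta (R : realType) (n : nat) (A : 'M[R]_n) (i j : 'I_n) :
  mxapp A (delta_mx ord0 j) ord0 i = A i j.
Proof.
rewrite mxappE (bigD1 j) //= big1 => [|l /negbTE lj].
  by rewrite mxE !eqxx mul1r addr0.
by rewrite mxE lj andbF mul0r.
Qed.

Lemma mxapp_le (R : realType) (n : nat) (A : 'M[R]_n) (u : 'rV[R]_n) :
  `|mxapp A u| <= n%:R * `|A| * `|u|.
Proof.
apply: norm_le_coord => [|i]; first by rewrite !mulr_ge0.
rewrite mxappE; apply: le_trans (ler_norm_sum _ _ _) _.
rewrite -mulrA mulr_natl -[X in _ *+ X](card_ord n) -sumr_const.
by apply: ler_sum => j _; rewrite normrM mulrC ler_pM // coord_norm_le.
Qed.

Lemma dot_mxapp_sym (R : realType) (n : nat) (A : 'M[R]_n) (u v : 'rV[R]_n) :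
  (forall i j, A i j = A j i) -> dot (mxapp A u) v = dot u (mxapp A v).
Proof.
move=> As; rewrite /dot.
under eq_bigr do rewrite mxappE mulr_suml.
under [RHS]eq_bigr do rewrite mxappE mulr_sumr.
rewrite exchange_big; apply: eq_bigr => i _; apply: eq_bigr => j _.
by rewrite As; ring.
Qed.

Lemma upd_delta (R : realType) (n : nat) (x : 'rV[R]_n) (i : 'I_n) (s : R) :
  upd x i s = x + (s - x ord0 i) *: delta_mx ord0 i.
Proof.
apply/rowP => j; rewrite !mxE eqxx /=.
by case: eqP => [->|_]; rewrite ?mulr1 ?mulr0; ring.
Qed.

(** Two-sided, so that it passes to differences and to [- k], unlike [axis_deriv_le]. *)
Definition axis_diff (R : realType) (n : nat) (k : 'rV[R]_n -> R)
    (i : 'I_n) (c : R) (p : 'rV[R]_n) : Prop :=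
  forall tau, 0 < tau -> exists2 d, 0 < d & forall x s, `|x - p| <= d ->
    `|upd x i s - p| <= d ->
    `|k (upd x i s) - k x - c * (s - x ord0 i)| <=
      tau * (`|x - p| + `|upd x i s - p|).

Lemma axis_diff_le (R : realType) (n : nat) (k : 'rV[R]_n -> R)
    (i : 'I_n) (c eps : R) (p : 'rV[R]_n) :
  axis_diff k i c p -> c <= eps -> axis_deriv_le k i eps p.
Proof.
move=> H ce tau tau0; have [d d0 hd] := H _ tau0; exists d => // x s xd ud xs.
have := hd x s xd ud; have : c * (s - x ord0 i) <= eps * (s - x ord0 i).
  by rewrite ler_wpM2r // subr_ge0.
rewrite ler_norml; lra.
Qed.

Lemma axis_diffB (R : realType) (n : nat) (k q : 'rV[R]_n -> R)
    (i : 'I_n) (c e : R) (p : 'rV[R]_n) :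
  axis_diff k i c p -> axis_diff q i e p ->
  axis_diff (fun x => k x - q x) i (c - e) p.
Proof.
move=> Hk Hq tau tau0; have t2 : 0 < tau / 2 by lra.
have [d1 d10 h1] := Hk _ t2; have [d2 d20 h2] := Hq _ t2.
exists (Num.min d1 d2); first by rewrite lt_min d10.
move=> x s; rewrite !le_min => /andP[x1 x2] /andP[u1 u2].
have := h1 x s x1 u1; have := h2 x s x2 u2; rewrite !ler_norml; lra.
Qed.

Lemma axis_diffN (R : realType) (n : nat) (k : 'rV[R]_n -> R)
    (i : 'I_n) (c : R) (p : 'rV[R]_n) :
  axis_diff k i c p -> axis_diff (fun x => - k x) i (- c) p.
Proof.
move=> Hk tau tau0; have [d d0 h] := Hk _ tau0; exists d => // x s xd ud.
by have := h x s xd ud; rewrite !ler_norml; lra.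
Qed.

Lemma differentiable_axis_diff (R : realType) (n : nat) (f : 'rV[R]_n -> R)
    (i : 'I_n) (p : 'rV[R]_n) :
  differentiable f p -> axis_diff f i ('d f p (delta_mx ord0 i)) p.
Proof.
move=> df tau tau0.
have /eqaddoP H := diff_locally df.
have /nbhs_norm0P[r /= r0 hr] := H _ tau0.
exists (r / 2); first by lra.
move=> x s xd ud.
have est y : `|y - p| <= r / 2 -> `|f y - f p - 'd f p (y - p)| <= tau * `|y - p|.
  move=> yd; have : `|f (y - p + p) - (f p + 'd f p (y - p))| <= tau * `|y - p|.
    by apply: hr => /=; lra.
  by rewrite subrK opprD addrA.
have hx := est _ xd; have hu := est _ ud.
have l : 'd f p (upd x i s - p) =
    'd f p (x - p) + 'd f p (delta_mx ord0 i) * (s - x ord0 i).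
  have -> : upd x i s - p = (x - p) + (s - x ord0 i) *: delta_mx ord0 i.
    by rewrite upd_delta addrAC.
  by rewrite linearD linearZ /= mulrC.
by move: hx hu; rewrite l !ler_norml; lra.
Qed.

Lemma rowDE (R : realType) (n : nat) (u v : 'rV[R]_n) i :
  (u + v) ord0 i = u ord0 i + v ord0 i.
Proof. by rewrite mxE. Qed.

Lemma rowBE (R : realType) (n : nat) (u v : 'rV[R]_n) i :
  (u - v) ord0 i = u ord0 i - v ord0 i.
Proof. by rewrite !mxE. Qed.

Lemma gradE (R : realType) (n : nat) (f : 'rV[R]_n -> \bar R)
    (x : 'rV[R]_n) (j : 'I_n) :
  grad f x ord0 j = 'd (fun y => fine (f y)) x (delta_mx ord0 j).
Proof. by rewrite /grad mxE. Qed.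

Lemma ext_hessian_local (R : realType) (n : nat) (phi : 'rV[R]_n -> \bar R)
    (xb : 'rV[R]_n) (A : 'M[R]_n) : is_ext_hessian phi xb A ->
  exists N L r0, [/\ lebesgue_outer N = 0%E, 0 < r0, 0 <= L,
    (forall x, `|x - xb| <= r0 -> phi x \is a fin_num) /\
    (forall x y, `|x - xb| <= r0 -> `|y - xb| <= r0 ->
      `|fine (phi x) - fine (phi y)| <= L * `|x - y|) &
    forall eps, 0 < eps -> exists2 r, 0 < r & forall p j, `|p - xb| <= r ->
      ~ N p -> differentiable (fun y => fine (phi y)) p /\
      `|'d (fun y => fine (phi y)) p (delta_mx ord0 j)
        - (grad phi xb ord0 j + mxapp A (p - xb) ord0 j)| <= eps * `|p - xb|].
Proof.
move=> [U [D [Unb [DU null] [Ufin lip] Ddiff lim]]].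
have /nbhs_ballP[r1 /= r10 r1U] := Unb.
have r1U' x : `|x - xb| <= r1 / 2 -> U x.
  by move=> xr; apply: r1U; rewrite -ball_normE /= distrC; lra.
have [L [L0 HL]] := pinfty_ex_gt0 lip.
exists (U `\` D), L, (r1 / 2); split => //; first by lra.
- exact: ltW.
- split; first by move=> x /r1U'; exact: Ufin.
  by move=> x y /r1U' Ux /r1U' Uy; exact: (HL (x, y)).
move=> eps eps0.
have n1 : 0 < n%:R + 1 :> R by rewrite ltr_wpDl.
(* The factor [n%:R + 1] pays for replacing the Euclidean norm by the sup norm. *)
have e0 : 0 < eps / (n%:R + 1) by rewrite divr_gt0.
have H2 : \forall x \near xb, x != xb -> D x -> `|(enorm (x - xb))^-1 *:
    (grad phi x - grad phi xb - mxapp A (x - xb))| <= eps / (n%:R + 1).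
  exact: (cvgr0_norm_le _ lim _ e0).
have /nbhs_ballP[r2 /= r20 hr2] := H2.
exists (Num.min (r1 / 2) (r2 / 2)); first by rewrite lt_min; lra.
move=> p j; rewrite le_min => /andP[p1 p2] Np.
have Up := r1U' _ p1.
have Dp : D p by apply: contrapT => nD; exact: Np.
split; first by have [] := Ddiff _ Dp.
rewrite -gradE.
have [->|pxb] := eqVneq p xb.
  by rewrite !subrr mxapp0 [(0 : 'rV_n) _ _]mxE addr0 subrr !normr0 mulr0.
have bp : ball xb r2 p by rewrite -ball_normE /= distrC; lra.
have := hr2 _ bp pxb Dp; rewrite normrZ.
have en0 : 0 < enorm (p - xb).
  by apply: lt_le_trans (norm_le_enorm _); rewrite normr_gt0 subr_eq0.
rewrite [X in X * _]ger0_norm ?invr_ge0 ?(ltW en0) // ler_pdivrMl // => h.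
rewrite opprD addrA.
rewrite -!rowBE.
apply: le_trans (coord_norm_le _ _ _) _; apply: le_trans h _.
apply: (@le_trans _ _ ((n%:R + 1) * `|p - xb| * (eps / (n%:R + 1)))).
  by rewrite ler_wpM2r ?enorm_le // ltW.
by rewrite le_eqVlt; apply/orP; left; apply/eqP; field; rewrite gt_eqF.
Qed.

(* A function whose [i]-th partial derivative is that of the quadratic model;
   no symmetry of [A] is assumed. *)
Definition axis_primitive (R : realType) (n : nat) (g : 'rV[R]_n)
    (A : 'M[R]_n) (xb : 'rV[R]_n) (i : 'I_n) (x : 'rV[R]_n) : R :=
  (x ord0 i - xb ord0 i) * mxapp A (x - xb) ord0 i
  - 2^-1 * A i i * (x ord0 i - xb ord0 i) ^+ 2 + g ord0 i * x ord0 i.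

Lemma mxapp_upd (R : realType) (n : nat) (A : 'M[R]_n)
    (xb x : 'rV[R]_n) (i j : 'I_n) (s : R) :
  mxapp A (upd x i s - xb) ord0 j =
  mxapp A (x - xb) ord0 j + (s - x ord0 i) * A j i.
Proof.
have -> : upd x i s - xb = (x - xb) + (s - x ord0 i) *: delta_mx ord0 i.
  by rewrite upd_delta addrAC.
by rewrite mxappD mxappZ rowDE [X in _ + X]mxE mxapp_delta.
Qed.

Lemma axis_primitive_step (R : realType) (n : nat) (g : 'rV[R]_n)
    (A : 'M[R]_n) (xb : 'rV[R]_n) (i : 'I_n) (x : 'rV[R]_n) (s : R) :
  axis_primitive g A xb i (upd x i s) - axis_primitive g A xb i x =
  (s - x ord0 i) * (g ord0 i + mxapp A (x - xb) ord0 i)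
  + 2^-1 * A i i * (s - x ord0 i) ^+ 2.
Proof. by rewrite /axis_primitive mxapp_upd upd_same; field. Qed.

Lemma axis_primitive_diff (R : realType) (n : nat) (g : 'rV[R]_n)
    (A : 'M[R]_n) (xb : 'rV[R]_n) (i : 'I_n) (p : 'rV[R]_n) :
  axis_diff (axis_primitive g A xb i) i
    (g ord0 i + mxapp A (p - xb) ord0 i) p.
Proof.
move=> tau tau0; set C := n%:R * `|A| + `|A|.
have C0 : 0 <= C by rewrite addr_ge0 // mulr_ge0.
exists (tau / (C + 1)); first by rewrite divr_gt0 //; lra.
move=> x s xd ud; rewrite axis_primitive_step.
set t := s - x ord0 i; set S := `|x - p| + _.
have tS : `|t| <= S.
  have -> : t = (upd x i s - p) ord0 i - (x - p) ord0 i.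
    by rewrite !mxE eqxx /t; ring.
  apply: le_trans (ler_normB _ _) _; rewrite addrC.
  by apply: lerD; exact: coord_norm_le.
have e1 : mxapp A (x - xb) ord0 i =
    mxapp A (p - xb) ord0 i + mxapp A (x - p) ord0 i.
  by rewrite -rowDE -mxappD [p - xb + _]addrC subrKA.
rewrite e1.
have -> : t * (g ord0 i + (mxapp A (p - xb) ord0 i + mxapp A (x - p) ord0 i))
  + 2^-1 * A i i * t ^+ 2 - (g ord0 i + mxapp A (p - xb) ord0 i) * t
  = t * (mxapp A (x - p) ord0 i + 2^-1 * A i i * t) by ring.
rewrite normrM mulrC; apply: ler_pM => //.
apply: le_trans (ler_normD _ _) _; rewrite !normrM.
have h1 := le_trans (coord_norm_le (mxapp A (x - p)) ord0 i) (mxapp_le A (x - p)).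
have h2 := coord_norm_le A i i.
have h3 : n%:R * `|A| * `|x - p| <= n%:R * `|A| * (tau / (C + 1)).
  by rewrite ler_wpM2l // mulr_ge0.
have h4 : `|A i i| * `|t| <= `|A| * (tau / (C + 1) + tau / (C + 1)).
  by apply: ler_pM => //; apply: le_trans tS _; exact: lerD.
have h5 : C * (tau / (C + 1)) <= tau.
  rewrite mulrCA -[leRHS]mulr1 ler_wpM2l ?(ltW tau0) // ler_pdivrMr //; lra.
rewrite ger0_norm ?invr_ge0 // -mulrA.
rewrite /C mulrDl in h5; lra.
Qed.

Lemma axis_primitive_lip (R : realType) (n : nat) (g : 'rV[R]_n)
    (A : 'M[R]_n) (xb : 'rV[R]_n) (i : 'I_n) (r : R) : 0 <= r ->
  exists2 L, 0 <= L & forall x y, `|x - xb| <= r -> `|y - xb| <= r ->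
    `|axis_primitive g A xb i x - axis_primitive g A xb i y| <= L * `|x - y|.
Proof.
move=> r0; set C := n%:R * `|A|; have C0 : 0 <= C by rewrite mulr_ge0.
exists (r * C + C * r + `|A| * r + `|g|).
  by rewrite !addr_ge0 // mulr_ge0.
move=> x y xr yr; rewrite /axis_primitive.
set a := x ord0 i - _; set b := y ord0 i - _.
set c := mxapp A (x - xb) ord0 i; set d := mxapp A (y - xb) ord0 i.
have ar : `|a| <= r.
  by apply: le_trans xr; have := coord_norm_le (x - xb) ord0 i; rewrite !mxE.
have br : `|b| <= r.
  by apply: le_trans yr; have := coord_norm_le (y - xb) ord0 i; rewrite !mxE.
have abE : x ord0 i - y ord0 i = a - b by rewrite /a /b; ring.
have ab : `|a - b| <= `|x - y|.
  by rewrite -abE; have := coord_norm_le (x - y) ord0 i; rewrite !mxE.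
have dr : `|d| <= C * r.
  apply: le_trans (coord_norm_le _ _ _) _; apply: le_trans (mxapp_le _ _) _.
  by rewrite ler_wpM2l.
have cd : `|c - d| <= C * `|x - y|.
  have -> : c - d = mxapp A (x - y) ord0 i.
    rewrite /c /d; have -> : x - y = (x - xb) + (- (y - xb)).
      by rewrite opprB addrA subrK.
    by rewrite [in RHS]mxappD [mxapp A (- (y - xb))]mxappN rowBE.
  by apply: le_trans (coord_norm_le _ _ _) _; exact: mxapp_le.
have -> : a * c - 2^-1 * A i i * a ^+ 2 + g ord0 i * x ord0 i -
    (b * d - 2^-1 * A i i * b ^+ 2 + g ord0 i * y ord0 i) =
    a * (c - d) + d * (a - b) - A i i * (2^-1 * (a + b)) * (a - b)
    + g ord0 i * (a - b) by rewrite /a /b; field.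
have h1 : `|a * (c - d)| <= r * (C * `|x - y|) by rewrite normrM ler_pM.
have h2 : `|d * (a - b)| <= C * r * `|x - y| by rewrite normrM ler_pM.
have h3 : `|A i i * (2^-1 * (a + b)) * (a - b)| <= `|A| * r * `|x - y|.
  rewrite !normrM; apply: ler_pM => //; rewrite ?mulr_ge0 //.
  apply: ler_pM => //; rewrite ?mulr_ge0 ?coord_norm_le //.
  rewrite ger0_norm ?invr_ge0 //; have := ler_normD a b; lra.
have h4 : `|g ord0 i * (a - b)| <= `|g| * `|x - y|.
  by rewrite normrM ler_pM // coord_norm_le.
apply: le_trans (ler_normD _ _) _; apply: le_trans (lerD (ler_normB _ _) h4) _.
have := ler_normD (a * (c - d)) (d * (a - b)).
by lra.
Qed.

(** [ae_axis_le] is applied to [k], the difference of [phi] and its axis primitive, and to [- k], on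
    the box of radius [2 * rho], where the partial derivative of [k] is at most
    [eps / 2 * (2 * rho)] off the null set. The doubled radius leaves the margin [rho] around points
    of the ball. The Lipschitz constant of [k] does not enter the estimate. *)
Lemma axis_expansion (R : realType) (n : nat) (phi : 'rV[R]_n -> \bar R)
    (xb : 'rV[R]_n) (A : 'M[R]_n) (eps : R) :
  is_ext_hessian phi xb A -> 0 < eps ->
  exists2 r, 0 < r & forall rho i x s, 0 < rho -> rho <= r ->
    `|x - xb| <= rho -> `|s - xb ord0 i| <= rho ->
    `|fine (phi (upd x i s)) - fine (phi x)
      - (s - x ord0 i) * (grad phi xb ord0 i + mxapp A (x - xb) ord0 i)
      - 2^-1 * A i i * (s - x ord0 i) ^+ 2| <= eps * rho * `|s - x ord0 i|.
Proof.
move=> /ext_hessian_local[N [L [r0 [null r00 L0 [_ lip] der]]]] eps0.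
have [r1 r10 hr1] := der (eps / 2) (divr_gt0 eps0 (ltr0Sn _ _)).
set f := fun y => fine (phi y) in lip hr1 *; set g := grad phi xb.
exists (Num.min r0 r1 / 2); first by rewrite divr_gt0 // lt_min r00.
move=> rho i x s rho0; rewrite ler_pdivlMr // le_min => /andP[rr0 rr1] xr sr.
set k := fun y => f y - axis_primitive g A xb i y.
pose a : 'rV[R]_n := \row_j (xb ord0 j - 2 * rho).
pose b : 'rV[R]_n := \row_j (xb ord0 j + 2 * rho).
have boxP y : box a b y -> `|y - xb| <= 2 * rho.
  move=> yb; apply: norm_le_coord => [|j]; first by lra.
  by rewrite !mxE ler_norml; have := yb j; rewrite !mxE; lra.
have [L' L'0 lip'] := axis_primitive_lip g A xb i (ltW (mulr_gt0 (ltr0Sn R 1) rho0)).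
have LL0 := addr_ge0 L0 L'0.
have lipk y z : box a b y -> box a b z -> `|k y - k z| <= (L + L') * `|y - z|.
  move=> /boxP yr /boxP zr.
  have := lip y z (le_trans yr _) (le_trans zr _); have := lip' y z yr zr.
  move=> h1 h2; have {}h2 : `|f y - f z| <= L * `|y - z| by apply: h2; lra.
  rewrite mulrDl; move: h1 h2; rewrite /k !ler_norml; lra.
have lipNk y z : box a b y -> box a b z -> `|- k y - - k z| <= (L + L') * `|y - z|.
  by move=> yb zb; rewrite -opprD normrN; exact: lipk.
have e0 : 0 <= eps * rho by rewrite ltW // mulr_gt0.
have derk p : box a b p -> ~ N p -> exists c, axis_diff k i c p /\ `|c| <= eps * rho.
  move=> /boxP pr Np; have [|df hp] := hr1 p i _ Np; first by lra.
  exists ('d f p (delta_mx ord0 i) - (g ord0 i + mxapp A (p - xb) ord0 i)); split.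
    by apply: axis_diffB; [exact: differentiable_axis_diff|exact: axis_primitive_diff].
  apply: (le_trans hp).
  by have := ler_wpM2l (ltW eps0) pr; lra.
have up y t : `|y - xb| <= rho -> `|t - xb ord0 i| <= rho -> y ord0 i <= t ->
    `|k (upd y i t) - k y| <= eps * rho * (t - y ord0 i).
  move=> yr tr yt.
  have yab j : a ord0 j <= y ord0 j - rho /\ y ord0 j + rho <= b ord0 j.
    rewrite !mxE; have := le_trans (coord_norm_le (y - xb) ord0 j) yr.
    by rewrite !mxE ler_norml; lra.
  have tb : t <= b ord0 i by rewrite mxE; move: tr; rewrite ler_norml; lra.
  have h1 := ae_axis_le e0 LL0 lipk null _ rho0 yab yt tb.
  have h2 := ae_axis_le e0 LL0 lipNk null _ rho0 yab yt tb.
  rewrite ler_norml; apply/andP; split.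
    rewrite lerNl opprB.
    have := h2; rewrite opprK addrC; apply => p pb Np.
    have [c [kc ce]] := derk p pb Np.
    apply: (axis_diff_le (axis_diffN kc)); apply: le_trans ce.
    by rewrite -normrN ler_norm.
  apply: h1 => p pb Np; have [c [kc ce]] := derk p pb Np.
  by apply: (axis_diff_le kc); apply: le_trans ce; rewrite ler_norm.
rewrite -addrA -opprD -axis_primitive_step.
rewrite (_ : _ - _ = k (upd x i s) - k x); last by rewrite /k /f; ring.
have [xs|sx] := leP (x ord0 i) s.
  by rewrite [X in _ * X]ger0_norm ?subr_ge0 //; exact: up.
(* For [s] below [x ord0 i] the same increment is read backwards, from [upd x i s] to [x]. *)
have := up (upd x i s) (x ord0 i).
rewrite upd_upd upd_same (_ : upd x i (x ord0 i) = x); last first.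
  by apply/rowP => j; rewrite updE; case: eqP => // ->.
have -> : `|s - x ord0 i| = x ord0 i - s.
  by rewrite distrC ger0_norm // subr_ge0 ltW.
move=> H; rewrite distrC; apply: H.
- apply: norm_le_coord => [|j]; first exact: ltW.
  rewrite !mxE; case: eqP => [->//|_].
  by have := le_trans (coord_norm_le (x - xb) ord0 j) xr; rewrite !mxE.
- by have := le_trans (coord_norm_le (x - xb) ord0 i) xr; rewrite !mxE.
- exact: ltW.
Qed.

(** Reaching the far corner of the square of side [t] through [x1] or through [x2] produces the
    mixed term [t ^ 2 * A j i] or [t ^ 2 * A i j]; the other terms cancel. Each of the four edges
    has error at most [eps / 4 * t * t], so [t ^ 2] can be divided out. *)
Lemma ext_hessian_sym (R : realType) (n : nat) (phi : 'rV[R]_n -> \bar R)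
    (xb : 'rV[R]_n) (A : 'M[R]_n) : is_ext_hessian phi xb A ->
  forall i j, A i j = A j i.
Proof.
move=> hA i j; have [->//|ij] := eqVneq i j.
apply/eqP; rewrite -subr_eq0 -normr_le0; apply/ler_addgt0Pr => eps eps0.
rewrite add0r.
have e4 : 0 < eps / 4 by lra.
have [t t0 ht] := axis_expansion hA e4.
have {}ht := ht t _ _ _ t0 (lexx _).
pose x1 := upd xb i (xb ord0 i + t); pose x2 := upd xb j (xb ord0 j + t).
have x0 : `|xb - xb| <= t by rewrite subrr normr0 ltW.
have near_xb l : `|upd xb l (xb ord0 l + t) - xb| <= t.
  rewrite upd_delta addrAC subrr add0r normrZ.
  rewrite [X in `|X|]addrAC subrr add0r ger0_norm ?(ltW t0) // ger_pMr //.
  apply: norm_le_coord => // k; rewrite !mxE.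
  by case: (_ && _); rewrite ?normr1 ?normr0.
have tt l : `|xb ord0 l + t - xb ord0 l| <= t.
  by rewrite addrAC subrr add0r ger0_norm // ltW.
have h1 := ht i xb _ x0 (tt i); have h2 := ht j xb _ x0 (tt j).
have h3 := ht j x1 _ (near_xb i) (tt j); have h4 := ht i x2 _ (near_xb j) (tt i).
have ji : (j == i) = false by rewrite eq_sym; apply/negbTE.
move: h1 h2 h3 h4; rewrite /x1 /x2 !mxapp_upd !updE ji (negbTE ij).
rewrite (updC _ _ _ ij) !subrr mxapp0 ![(0 : 'rV_n) _ _]mxE.
rewrite ![_ + t - _]addrAC !subrr !add0r !addr0.
rewrite -/x1 -/x2 !(gtr0_norm t0) !ler_norml.
set f3 := fine (phi (upd _ _ _)); set f1 := fine (phi x1).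
set f2 := fine (phi x2); set f0 := fine (phi xb).
move=> h1 h2 h3 h4.
have tt0 : 0 < t * t by rewrite mulr_gt0.
by apply/andP; split; rewrite -(ler_pM2r tt0); lra.
Qed.

(** The path from [x] to [y] changes one coordinate at a time, and the sup norm keeps all
    intermediate points in the ball. *)
Lemma axis_path (R : realType) (n : nat) (K : 'rV[R]_n -> R) (xb : 'rV[R]_n)
    (rho c : R) : 0 <= rho -> 0 <= c ->
  (forall i x s, `|x - xb| <= rho -> `|s - xb ord0 i| <= rho ->
    `|K (upd x i s) - K x| <= c * `|s - x ord0 i|) ->
  forall x y, `|x - xb| <= rho -> `|y - xb| <= rho ->
    `|K y - K x| <= n%:R * c * `|y - x|.
Proof.
move=> rho0 c0 H x y xr yr.
pose z (m : nat) : 'rV[R]_n := \row_j (if (j < m)%N then y ord0 j else x ord0 j).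
have cx j : `|x ord0 j - xb ord0 j| <= rho.
  by rewrite -rowBE; exact: le_trans (coord_norm_le _ _ _) xr.
have cy j : `|y ord0 j - xb ord0 j| <= rho.
  by rewrite -rowBE; exact: le_trans (coord_norm_le _ _ _) yr.
have zr m : `|z m - xb| <= rho.
  by apply: norm_le_coord => // j; rewrite !mxE; case: ifP.
have zn : z n = y by apply/rowP => j; rewrite mxE ltn_ord.
have z0 : z 0%N = x by apply/rowP => j; rewrite mxE.
have step m : (m <= n)%N -> `|K (z m) - K x| <= m%:R * c * `|y - x|.
  elim: m => [_|m IH mn]; first by rewrite z0 subrr normr0 !mul0r.
  pose i := Ordinal mn.
  have -> : z m.+1 = upd (z m) i (y ord0 i).
    apply/rowP => j; rewrite updE !mxE ltnS leq_eqVlt.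
    have [->|ji] := eqVneq j i; first by rewrite eqxx.
    by have -> : (j == m :> nat) = false by apply/negbTE; exact: ji.
  have := H i (z m) (y ord0 i) (zr m) (cy i).
  have -> : z m ord0 i = x ord0 i by rewrite mxE ltnn.
  have yx : `|y ord0 i - x ord0 i| <= `|y - x|.
    by rewrite -rowBE; exact: coord_norm_le.
  have := ler_wpM2l c0 yx; have := IH (ltnW mn).
  move=> h1 h2 h3; rewrite -natr1.
  apply: le_trans (ler_distD (K (z m)) _ _) _; lra.
by have := step n (leqnn n); rewrite zn.
Qed.

(** The remainder of [f] after its second order expansion at [xb] is Lipschitz, with a constant that
    vanishes at [xb]. The model is expanded at [x], which for symmetric [A] gives the same
    increment, so that [x] can be the base point of a subgradient inequality. *)
Definition quad_approx (R : realType) (n : nat) (f : 'rV[R]_n -> R)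
    (g : 'rV[R]_n) (A : 'M[R]_n) (xb : 'rV[R]_n) : Prop :=
  forall eps, 0 < eps -> exists2 r, 0 < r & forall x y,
    `|x - xb| <= r -> `|y - xb| <= r ->
    `|f y - f x - dot (g + mxapp A (x - xb)) (y - x)
      - 2^-1 * dot (mxapp A (y - x)) (y - x)|
      <= eps * (`|x - xb| + `|y - xb|) * `|y - x|.

Lemma ext_hessian_quad_approx (R : realType) (n : nat)
    (phi : 'rV[R]_n -> \bar R) (xb : 'rV[R]_n) (A : 'M[R]_n) :
  is_ext_hessian phi xb A ->
  quad_approx (fun x => fine (phi x)) (grad phi xb) A xb.
Proof.
move=> hA eps eps0; have As := ext_hessian_sym hA.
have n1 : 0 < n%:R + 1 :> R by rewrite ltr_wpDl.
have e0 : 0 < eps / (n%:R + 1) by rewrite divr_gt0.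
have [r r0 hr] := axis_expansion hA e0.
set g := grad phi xb in hr *; set f := fun x => fine (phi x) in hr *.
exists (r / 2); first by lra.
move=> x y xr yr; set rho := `|x - xb| + `|y - xb|.
have x0 := normr_ge0 (x - xb); have y0 := normr_ge0 (y - xb).
have [rho0|rho0] := leP rho 0.
  have xe : x = xb.
    by apply/eqP; rewrite -subr_eq0 -normr_le0; rewrite /rho in rho0; lra.
  have ye : y = xb.
    by apply/eqP; rewrite -subr_eq0 -normr_le0; rewrite /rho in rho0; lra.
  by rewrite xe ye !subrr !dot0r !normr0 mulr0 !subr0 mulr0 normr0.
pose K x := f x - dot g (x - xb) - 2^-1 * dot (mxapp A (x - xb)) (x - xb).
have Kdiff u v : K v - K u = f v - f u - dot (g + mxapp A (u - xb)) (v - u)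
    - 2^-1 * dot (mxapp A (v - u)) (v - u).
  have -> : v - u = (v - xb) - (u - xb) by rewrite opprB addrA subrK.
  rewrite /K; move: (u - xb) (v - xb) => a b.
  rewrite !(mxappD, mxappN, dotDl, dotDr, dotNl, dotNr).
  (* Symmetry of [A] identifies the two cross terms, so the increment of the model at [xb] is its
     expansion at [u]. *)
  have -> : dot (mxapp A b) a = dot (mxapp A a) b.
    by rewrite dot_mxapp_sym // dotC.
  by field.
have e1 : 0 <= eps / (n%:R + 1) * rho by rewrite mulr_ge0 ?ltW.
have := @axis_path R n K xb rho _ (ltW rho0) e1 _ x y.
rewrite -Kdiff => H.
apply: le_trans (H _ _ _) _.
- move=> i u s ur sr; rewrite Kdiff.
  have := hr rho i u s rho0 _ ur sr.
  have -> : upd u i s - u = (s - u ord0 i) *: delta_mx ord0 i.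
    by rewrite upd_delta addrAC subrr add0r.
  rewrite dotDl mxappZ !dotZr dotZl !dot_delta mxapp_delta => h.
  rewrite /f; set t := s - u ord0 i in h *.
  apply: le_trans (h _); last by rewrite /rho; lra.
  by rewrite le_eqVlt; apply/orP; left; apply/eqP; congr `|_|; ring.
- by rewrite lerDl.
- by rewrite lerDr.
apply: ler_wpM2r => //; rewrite mulrA; apply: ler_wpM2r; first exact: ltW.
rewrite mulrCA -[leRHS]mulr1 ler_wpM2l ?(ltW eps0) // ler_pdivrMr //; lra.
Qed.

(** With it, passing from [phi + psi] back to [psi] is again the addition of a function with a
    quadratic expansion. *)
Lemma quad_approxN (R : realType) (n : nat) (f : 'rV[R]_n -> R)
    (g : 'rV[R]_n) (A : 'M[R]_n) (xb : 'rV[R]_n) :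
  quad_approx f g A xb -> quad_approx (fun x => - f x) (- g) (- A) xb.
Proof.
move=> H eps eps0; have [r r0 hr] := H _ eps0; exists r => // x y xr yr.
rewrite !mxappNl -(opprD g) !dotNl -[leLHS]normrN.
by apply: (le_trans _ (hr x y xr yr)); rewrite le_eqVlt; apply/orP; left;
  apply/eqP; congr `|_|; ring.
Qed.

(** * Lower limits along directions *)

Lemma limf_einf_near (R : realType) (T : choiceType)
    (X : filteredType T) (f g : X -> \bar R)
    (F : set_system X) : Filter F ->
  (\forall x \near F, f x = g x) -> limf_einf f F = limf_einf g F.
Proof.
move=> FF; have le (h k : X -> \bar R) : (\forall x \near F, h x = k x) ->
    (limf_einf h F <= limf_einf k F)%E.
  move=> hk; rewrite !limf_einfE; apply: ge_ereal_sup => _ [V FV <-].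
  apply: (@le_trans _ _ (ereal_inf (k @` (V `&` [set x | h x = k x])))).
    apply: le_ereal_inf => _ [x [Vx /= e] <-]; rewrite -e; by exists x.
  by apply: ereal_sup_ubound; exists (V `&` [set x | h x = k x]) => //; exact: filterI.
move=> fg; apply/eqP; rewrite eq_le le //= le //.
by apply: filterS fg => x ->.
Qed.

(** Only the inequality from below is proved directly; the opposite one is the same inequality for
    [f + c] and [- c]. *)
Lemma limf_einfDr (R : realType) (T : choiceType)
    (X : filteredType T) (f : X -> \bar R)
    (c : X -> R) (c0 : R) (F : set_system X) : Filter F ->
  c x @[x --> F] --> c0 ->
  limf_einf (fun x => f x + (c x)%:E)%E F = (limf_einf f F + c0%:E)%E.
Proof.
move=> FF; have le (h : X -> \bar R) (d : X -> R) (d0 : R) : d x @[x --> F] --> d0 ->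
    (limf_einf h F + d0%:E <= limf_einf (fun x => h x + (d x)%:E)%E F)%E.
  move=> dd; apply/lee_addgt0Pr => e e0; rewrite -leeBrDr //.
  rewrite [in leLHS]limf_einfE; apply: ge_ereal_sup => _ [V FV <-].
  rewrite leeBrDr // -leeBlDr //.
  pose V' := V `&` [set x | d0 - e <= d x].
  have FV' : F V'.
    by apply: filterI => //; apply: (cvgr_ge _ dd); rewrite gtrBl.
  rewrite [leRHS]limf_einfE.
  apply: (@le_trans _ _ (ereal_inf ((fun x => h x + (d x)%:E)%E @` V'))); last first.
    by apply: ereal_sup_ubound; exists V'.
  apply: le_ereal_inf_tmp => _ [x [Vx /= dx] <-].
  rewrite -addeA -EFinB; apply: leeD; last by rewrite lee_fin.
  by apply: ereal_inf_lbound; exists x.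
move=> cc; apply/eqP; rewrite eq_le le // andbT.
rewrite -leeBlDr //.
apply: le_trans (le (fun x => f x + (c x)%:E)%E (fun x => - c x) (- c0) _) _.
  exact: cvgN.
rewrite le_eqVlt; apply/orP; left; apply/eqP; apply: limf_einf_near.
by apply: nearW => x; rewrite EFinN addeK.
Qed.

Lemma dir_filter_near (R : realType) (n : nat) (w : 'rV[R]_n)
    (P : set (R * 'rV[R]_n)) (d : R) : 0 < d ->
  (forall t u, 0 < t -> t <= d -> `|u - w| <= d -> P (t, u)) ->
  filter_prod 0^'+ (nbhs w) P.
Proof.
move=> d0 H; exists ([set t | 0 < t <= d], [set u | `|u - w| <= d]) => /=.
  split.
    apply/nbhs_ballP; exists d => //= t; rewrite /ball/= sub0r normrN => td t0.
    by rewrite t0 /= (le_trans (ler_norm _)) // ltW.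
  by apply/nbhs_ballP; exists d => //= u; rewrite -ball_normE /= distrC => /ltW.
by move=> [t u] /= [/andP[t0 td] ud]; exact: H.
Qed.

Lemma dir_filter_cvg (R : realType) (n : nat) (w : 'rV[R]_n)
    (c : R * 'rV[R]_n -> R) (c0 : R) :
  (forall eps, 0 < eps -> exists2 d, 0 < d & forall t u, 0 < t -> t <= d ->
    `|u - w| <= d -> `|c (t, u) - c0| <= eps) ->
  c p @[p --> filter_prod 0^'+ (nbhs w)] --> c0.
Proof.
move=> H; apply/cvgrPdist_le => e e0; have [d d0 hd] := H _ e0.
by apply: (dir_filter_near d0) => t u t0 td ud /=; rewrite distrC hd.
Qed.

Lemma quad_approx_second (R : realType) (n : nat) (f : 'rV[R]_n -> R)
    (g : 'rV[R]_n) (A : 'M[R]_n) (xb w : 'rV[R]_n) (eps : R) :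
  quad_approx f g A xb -> 0 < eps ->
  exists2 d, 0 < d & forall t u, 0 < t -> t <= d -> `|u - w| <= d ->
    `|(f (xb + t *: u) - f xb - t * dot g u) * (2^-1 * t ^+ 2)^-1
      - dot w (mxapp A w)| <= eps.
Proof.
move=> H eps0.
set W := `|w| + 1; have W0 : 0 < W by rewrite ltr_wpDl.
have W20 : 0 < 4 * W ^+ 2 by rewrite mulr_gt0 // exprn_gt0.
(* For |u| <= W the remainder is at most [t ^ 2 * (eps / 4)], that is [eps / 2] after division by
   [t ^ 2 / 2]. The constant [C] below bounds the change of the quadratic form between [u] and
   [w]. *)
have [r r0 hr] := H (eps / (4 * W ^+ 2)) (divr_gt0 eps0 W20).
set C := n%:R * (n%:R * `|A|) * (2 * W).
have C0 : 0 <= C by rewrite !mulr_ge0 // ltW.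
have C1 : 0 < 2 * (C + 1) by lra.
exists (Num.min 1 (Num.min (r / W) (eps / (2 * (C + 1))))).
  by rewrite !lt_min ltr01 !divr_gt0.
move=> t u t0; rewrite !le_min => /and3P[t1 tr _] /and3P[u1 _ ue].
have uW : `|u| <= W.
  have -> : u = w + (u - w) by rewrite addrC subrK.
  by apply: le_trans (ler_normD _ _) _; rewrite lerD2l.
have tu : `|t *: u| <= r.
  rewrite normrZ gtr0_norm //; apply: le_trans (ler_pM _ _ tr uW) _ => //.
    exact: ltW.
  by rewrite divfK // gt_eqF.
have := hr xb (xb + t *: u); rewrite subrr normr0 add0r mxapp0 addr0.
rewrite -[xb + _ - xb]addrAC subrr add0r => /(_ (ltW r0) tu).
rewrite mxappZ !dotZr dotZl normrZ (gtr0_norm t0) => h1.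
have tt : 0 < 2^-1 * t ^+ 2 by rewrite mulr_gt0 ?invr_gt0 // exprn_gt0.
set N := f _ - _ - _ in h1 *.
have h2 : `|N - 2^-1 * t ^+ 2 * dot (mxapp A u) u| <=
    (eps / 2) * (2^-1 * t ^+ 2).
  have -> : 2^-1 * t ^+ 2 * dot (mxapp A u) u =
    2^-1 * (t * (t * dot (mxapp A u) u)) by ring.
  apply: le_trans h1 _.
  have uu : `|u| ^+ 2 <= W ^+ 2 by rewrite !expr2 ler_pM.
  have -> : eps / (4 * W ^+ 2) * (t * `|u|) * (t * `|u|) =
    (t ^+ 2 * (eps / 4)) * (`|u| ^+ 2 / W ^+ 2).
    by field; rewrite gt_eqF.
  have -> : eps / 2 * (2^-1 * t ^+ 2) = (t ^+ 2 * (eps / 4)) * 1 by field.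
  apply: ler_wpM2l; first by rewrite mulr_ge0 ?sqr_ge0 // divr_ge0 // ltW.
  by rewrite ler_pdivrMr ?exprn_gt0 // mul1r.
have h3 : `|N * (2^-1 * t ^+ 2)^-1 - dot (mxapp A u) u| <= eps / 2.
  have -> : N * (2^-1 * t ^+ 2)^-1 - dot (mxapp A u) u =
     (N - 2^-1 * t ^+ 2 * dot (mxapp A u) u) * (2^-1 * t ^+ 2)^-1.
    by field; rewrite gt_eqF.
  by rewrite normrM [X in _ * X]gtr0_norm ?invr_gt0 // ler_pdivrMr.
have h4 : `|dot (mxapp A u) u - dot w (mxapp A w)| <= eps / 2.
  have -> : dot (mxapp A u) u - dot w (mxapp A w) =
      dot (mxapp A (u - w)) u + dot (mxapp A w) (u - w).
    rewrite [dot w _]dotC mxappD mxappN !(dotDl, dotDr, dotNl, dotNr); ring.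
  have d1 : `|dot (mxapp A (u - w)) u| <= n%:R * (n%:R * `|A|) * W * `|u - w|.
    apply: le_trans (dot_le _ _) _.
    rewrite -[leRHS]mulrA -[leLHS]mulrA -[leRHS]mulrA ler_wpM2l //.
    rewrite [W * _]mulrC mulrA; apply: ler_pM => //; exact: mxapp_le.
  have d2 : `|dot (mxapp A w) (u - w)| <= n%:R * (n%:R * `|A|) * W * `|u - w|.
    apply: le_trans (dot_le _ _) _; apply: ler_wpM2r => //.
    rewrite -mulrA; apply: ler_wpM2l => //.
    apply: le_trans (mxapp_le _ _) _; apply: ler_wpM2l; first exact: mulr_ge0.
    by rewrite /W lerDl.
  apply: le_trans (ler_normD _ _) _; apply: le_trans (lerD d1 d2) _.
  apply: (@le_trans _ _ (C * (eps / (2 * (C + 1))))).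
    have := ler_wpM2l C0 ue; rewrite /C; lra.
  rewrite mulrA ler_pdivrMr // -subr_ge0.
  rewrite [X in 0 <= X](_ : _ = eps); first exact: ltW.
  by field.
have := ler_normD (N * (2^-1 * t ^+ 2)^-1 - dot (mxapp A u) u)
  (dot (mxapp A u) u - dot w (mxapp A w)).
rewrite addrA subrK; lra.
Qed.

(** The second order quotient, taken with tolerance 1, is bounded, and it enters the first order
    quotient with the factor [t / 2]. *)
Lemma quad_approx_first (R : realType) (n : nat) (f : 'rV[R]_n -> R)
    (g : 'rV[R]_n) (A : 'M[R]_n) (xb w : 'rV[R]_n) (eps : R) :
  quad_approx f g A xb -> 0 < eps ->
  exists2 d, 0 < d & forall t u, 0 < t -> t <= d -> `|u - w| <= d ->
    `|(f (xb + t *: u) - f xb) * t^-1 - dot g w| <= eps.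
Proof.
move=> H eps0.
have [d1 d10 h1] := @quad_approx_second _ _ _ _ _ _ w 1 H ltr01.
set C := `|dot w (mxapp A w)| + 1; have C0 : 0 < C by rewrite ltr_wpDl.
set G := n%:R * `|g| + 1; have G0 : 0 < G by rewrite ltr_wpDl // mulr_ge0.
exists (Num.min d1 (Num.min (eps / C) (eps / (2 * G)))).
  by rewrite !lt_min d10 !divr_gt0 // mulr_gt0.
move=> t u t0; rewrite !le_min => /and3P[t1 tC _] /and3P[u1 _ uG].
have := h1 t u t0 t1 u1.
set N := (_ * _^-1) => h.
have -> : (f (xb + t *: u) - f xb) * t^-1 - dot g w =
    2^-1 * t * N + dot g (u - w).
  by rewrite /N dotDr dotNr; field; rewrite gt_eqF.
apply: le_trans (ler_normD _ _) _.
have hN : `|N| <= C.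
  rewrite /C; have := ler_normD (N - dot w (mxapp A w)) (dot w (mxapp A w)).
  by rewrite subrK; lra.
have a1 : `|2^-1 * t * N| <= eps / 2.
  rewrite normrM gtr0_norm ?mulr_gt0 ?invr_gt0 //.
  have : t * `|N| <= eps / C * C by apply: ler_pM => //; exact: ltW.
  rewrite divfK ?gt_eqF //; lra.
have a2 : `|dot g (u - w)| <= eps / 2.
  apply: le_trans (dot_le _ _) _.
  have : G * `|u - w| <= G * (eps / (2 * G)) by rewrite ler_pM2l.
  have -> : G * (eps / (2 * G)) = eps / 2 by field; rewrite gt_eqF.
  by have := normr_ge0 (u - w); rewrite /G; lra.
lra.
Qed.

(** Splits a difference quotient of [phi + psi] into one of [psi] and a real one of [phi]. The value
    [y] of [psi] may be infinite; [0 < k] then gives the same infinity on both sides. *)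
Lemma fin_add_quotient (R : realType) (y : \bar R) (fa fb p s s' k : R) :
  0 < k ->
  ((fa%:E + y - (fb%:E + p%:E) - s%:E) * k%:E =
   (y - p%:E - s'%:E) * k%:E + ((fa - fb - s + s') * k)%:E)%E.
Proof.
move=> k0; case: y => [y| |] //=.
- by rewrite -!(EFinD, EFinN, EFinM); congr (_%:E); ring.
- by rewrite !gt0_mulye ?lte_fin.
- by rewrite !gt0_mulNye ?lte_fin.
Qed.

(** * Subgradients and tangent vectors *)

Lemma ereal_dense (R : realType) (x y : \bar R) : (x < y)%E ->
  exists a : R, (x < a%:E /\ a%:E < y)%E.
Proof.
case: x => [p| |]; case: y => [q| |] //.
- by rewrite lte_fin => pq; exists ((p + q) / 2); rewrite !lte_fin; lra.
- by move=> _; exists (p + 1); rewrite lte_fin ltry; split => //; lra.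
- by move=> _; exists (q - 1); rewrite lte_fin ltNyr; split => //; lra.
- by move=> _; exists 0; rewrite ltNyr ltry.
Qed.

(** If the infimum [m] were not attained, every point of [K] would have a neighbourhood on which [f]
    exceeds all values close to [m]; compactness makes this uniform and yields a value of [f] below
    all its values. The filter [F] expresses closeness to [m] among the values, also for
    [m = -oo]. *)
Lemma lsc_min (R : realType) (V : topologicalType) (f : V -> \bar R)
    (K : set V) : compact K -> K !=set0 -> (forall x, K x -> lsc_at f x) ->
  exists2 x, K x & forall y, K y -> (f x <= f y)%E.
Proof.
move=> cK [x0 Kx0] lsc; set m := ereal_inf (f @` K).
have mf y : K y -> (m <= f y)%E by move=> Ky; apply: ereal_inf_lbound; exists y.
apply: contrapT => nex.
have mlt x : K x -> (m < f x)%E.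
  move=> Kx; rewrite lt_neqAle mf // andbT; apply/eqP => e.
  by apply: nex; exists x => // y Ky; rewrite -e mf.
pose F := filter_from [set b | (m < b)%E] (fun b => [set i | (i < b)%E /\ (f @` K) i]).
have FF : Filter F.
  apply: filter_from_filter; first by exists +oo%E; exact: lt_le_trans (mlt _ Kx0) (leey _).
  move=> b c /= mb mc; exists (Order.min b c); first by rewrite lt_min mb.
  by move=> i [/=]; rewrite lt_min => /andP[ib ic] fi.
have /compact_near_coveringP/(_ _ F (fun i x => (i < f x)%E) FF) H := cK.
have [x Kx|b /= mb hb] := H.
  have [a [ma ax]] := ereal_dense (mlt _ Kx).
  exists ([set y | (a%:E < f y)%E], [set i | (i < a%:E)%E /\ (f @` K) i]) => /=.
    by split; [exact: lsc|exists a%:E].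
  by move=> [y i] /= [ay [ia _]]; exact: lt_trans ia ay.
have [i fi ib] := ereal_inf_lt mb.
have [y Ky yi] := fi.
have := hb i (conj ib fi) y Ky => /=.
by rewrite yi ltxx.
Qed.

Lemma lsc_atD (R : realType) (V : topologicalType) (f : V -> \bar R)
    (c : V -> R) (x : V) : lsc_at f x -> {for x, continuous c} ->
  lsc_at (fun y => f y + (c y)%:E)%E x.
Proof.
move=> fx cx a; rewrite -lteBlDr // => h.
have [e e0 he] : exists2 e, 0 < e & ((a - c x + e)%:E < f x)%E.
  case: (f x) h => [b| |] //; last by exists 1; rewrite ?ltry.
  by rewrite -EFinB lte_fin => ab; exists ((b - (a - c x)) / 2);
    rewrite ?lte_fin; lra.
have H1 := fx _ he.
have H2 : \forall y \near x, c x - e < c y.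
  by apply: (cvgr_gt _ cx); rewrite gtrBl.
apply: filterS2 H1 H2 => y h1 h2; rewrite -lteBlDr //.
by apply: lt_trans h1; rewrite -EFinB lte_fin; lra.
Qed.

Lemma ninfty_fin (R : realType) (T : Type) (f : T -> \bar R) (x : T) :
  ninfty_free f -> (f x < +oo)%E -> f x \is a fin_num.
Proof. by move=> nf fx; rewrite fin_numElt nf. Qed.

(** Multiplying out the quotient leaves a finite left-hand side, so the inequality is trivial where
    [f y = +oo]; the factor between the two norms disappears in [eps]. *)
Lemma frechetP (R : realType) (n : nat) (f : 'rV[R]_n -> \bar R)
    (x v : 'rV[R]_n) : ninfty_free f ->
  frechet_subdiff f x v <-> (f x < +oo)%E /\ forall eps, 0 < eps ->
    exists2 d, 0 < d & forall y, `|y - x| <= d ->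
      (f x + (dot v (y - x) - eps * `|y - x|)%:E <= f y)%E.
Proof.
move=> nf.
have n1 : 0 < n%:R + 1 :> R by rewrite ltr_wpDl.
split=> [[fx lim]|[fx H]]; split => //.
  have := ninfty_fin nf fx; case E : (f x) => [p| |] // _ eps eps0.
  have e0 : 0 < eps / (n%:R + 1) by rewrite divr_gt0.
  move: lim; rewrite E limf_einfE => lim.
  have /ereal_sup_gt[_ [V Vx <-] Vinf] : ((- (eps / (n%:R + 1)))%:E <
     ereal_sup [set ereal_inf ((fun y : 'rV[R]_n => (f y - p%:E - (dot v (y - x)%R)%:E) *
       ((enorm (y - x)%R)^-1)%:E) @` V) | V in x^'])%E.
    by apply: lt_le_trans lim; rewrite lte_fin oppr_lt0.
  have /nbhs_ballP[d /= d0 hd] : nbhs x [set y | y != x -> V y] by exact: Vx.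
  exists (d / 2); first by lra.
  move=> y yd; have [->|yx] := eqVneq y x.
    by rewrite subrr dot0r normr0 mulr0 subr0 adde0 E.
  have Vy : V y by apply: hd => //; rewrite -ball_normE /= distrC; lra.
  have en0 : 0 < enorm (y - x).
    by apply: lt_le_trans (norm_le_enorm _); rewrite normr_gt0 subr_eq0.
  have : ((- (eps / (n%:R + 1)))%:E < (f y - p%:E - (dot v (y - x)%R)%:E) *
       ((enorm (y - x)%R)^-1)%:E)%E.
    by apply: lt_le_trans Vinf _; apply: ereal_inf_lbound; exists y.
  have := nf y; case: (f y) => [q| |] // _; last by rewrite leey.
  rewrite -!(EFinB, EFinM, EFinD) lte_fin lee_fin ltr_pdivlMr // => h.
  have := enorm_le (y - x) => h2.
  have h3 : eps / (n%:R + 1) * enorm (y - x) <= eps * `|y - x|.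
    apply: (@le_trans _ _ (eps / (n%:R + 1) * ((n%:R + 1) * `|y - x|))).
      by rewrite ler_wpM2l // ltW.
    by rewrite mulrA divfK // gt_eqF.
  rewrite mulNr in h; lra.
have := ninfty_fin nf fx; case E : (f x) => [p| |] // _.
apply/lee_addgt0Pr => e e0; have [d d0 hd] := H _ e0.
rewrite -leeBlDr // sub0e limf_einfE.
apply: (@le_trans _ _ (ereal_inf ((fun y : 'rV[R]_n => (f y - p%:E - (dot v (y - x)%R)%:E) *
       ((enorm (y - x)%R)^-1)%:E)%E @` [set y | `|y - x| <= d /\ y != x]))); last first.
  apply: ereal_sup_ubound; exists [set y | `|y - x| <= d /\ y != x] => //.
  apply/nbhs_ballP; exists d => //= y; rewrite -ball_normE /= distrC => yd yx.
  by split => //; exact: ltW.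
apply: le_ereal_inf_tmp => _ [y [yd yx] <-].
have en0 : 0 < enorm (y - x).
  by apply: lt_le_trans (norm_le_enorm _); rewrite normr_gt0 subr_eq0.
have := hd y yd; rewrite E.
have := nf y; case: (f y) => [q| |] // _; last first.
  by rewrite gt0_mulye ?leey // lte_fin invr_gt0.
rewrite -!(EFinB, EFinM, EFinD, EFinN) !lee_fin ler_pdivlMr // => h.
have := ler_wpM2l (ltW e0) (norm_le_enorm (y - x)); lra.
Qed.

(** Tolerances replace sequences; the converse picks a pair for each tolerance [k.+1%:R^-1]. A
    Frechet subgradient at [x'] forces [f x'] to be finite, which makes [fine (f x')] meaningful. *)
Lemma limitingP (R : realType) (n : nat) (f : 'rV[R]_n -> \bar R)
    (x v : 'rV[R]_n) : ninfty_free f ->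
  limiting_subdiff f x v <-> (f x < +oo)%E /\ forall eps, 0 < eps ->
    exists x' v', [/\ `|x' - x| <= eps, `|fine (f x') - fine (f x)| <= eps,
      `|v' - v| <= eps & frechet_subdiff f x' v'].
Proof.
move=> nf; split=> [[fx [x_ [v_ [xx ff vv sub]]]]|[fx H]]; split => //.
  move=> eps eps0.
  have ffin := ninfty_fin nf fx.
  have /fine_cvgP[_ fcv] : f (x_ k) @[k --> \oo] --> (fine (f x))%:E.
    by rewrite fineK.
  have /cvgrPdist_le/(_ _ eps0) h1 := xx.
  have /cvgrPdist_le/(_ _ eps0) h2 := fcv.
  have /cvgrPdist_le/(_ _ eps0) h3 := vv.
  have [k [k1 k2 k3]] : exists k, [/\ `|x - x_ k| <= eps,
      `|fine (f x) - fine (f (x_ k))| <= eps & `|v - v_ k| <= eps].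
    have /filter_ex[k [[k1 k2] k3]] : \forall k \near \oo, (`|x - x_ k| <= eps /\
      `|fine (f x) - fine (f (x_ k))| <= eps) /\ `|v - v_ k| <= eps.
      by apply: filterI => //; apply: filterI.
    by exists k; split.
  by exists (x_ k), (v_ k); split; rewrite 1?distrC.
have ffin := ninfty_fin nf fx.
have seqP k : exists p : 'rV[R]_n * 'rV[R]_n, [/\ `|p.1 - x| <= k.+1%:R^-1,
    `|fine (f p.1) - fine (f x)| <= k.+1%:R^-1, `|p.2 - v| <= k.+1%:R^-1 &
    frechet_subdiff f p.1 p.2].
  have [|x' [v' h]] := H (k.+1%:R^-1); first by rewrite invr_gt0.
  by exists (x', v').
have [p hp] := choice seqP.
have small eps : 0 < eps -> \forall k \near \oo, k.+1%:R^-1 <= eps :> R.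
  by move=> e0; apply: (cvgr_le _ (@cvg_harmonic R) _ e0).
exists (fun k => (p k).1), (fun k => (p k).2); split.
- apply/cvgrPdist_le => e e0; apply: filterS (small e e0) => k.
  by have [h _ _ _] := hp k; rewrite distrC; exact: le_trans.
- rewrite -(fineK ffin); apply/fine_cvgP; split.
    apply: nearW => k; have [_ _ _ [h _]] := hp k; exact: ninfty_fin.
  apply/cvgrPdist_le => e e0; apply: filterS (small e e0) => k.
  by have [_ h _ _] := hp k; rewrite distrC; exact: le_trans.
- apply/cvgrPdist_le => e e0; apply: filterS (small e e0) => k.
  by have [_ _ h _] := hp k; rewrite distrC; exact: le_trans.
- by move=> k; have [] := hp k.
Qed.

Lemma frechet_limiting (R : realType) (n : nat) (f : 'rV[R]_n -> \bar R)
    (x v : 'rV[R]_n) : ninfty_free f ->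
  frechet_subdiff f x v -> limiting_subdiff f x v.
Proof.
move=> nf fv; apply/limitingP => //; split; first by case: fv.
move=> eps /ltW e0; exists x, v; split => //; by rewrite subrr normr0.
Qed.

Lemma tangent_coneP (R : realType) (V : normedModType R) (S : set V) (x v : V) :
  tangent_cone S x v <-> S x /\ forall eps, 0 < eps ->
    exists t u, [/\ 0 < t, t <= eps, `|u - v| <= eps & S (x + t *: u)].
Proof.
split=> [[Sx [t_ [v_ [t0 tt vv St]]]]|[Sx H]]; split => //.
  move=> eps eps0.
  have /cvgrPdist_le/(_ _ eps0) h1 := tt.
  have /cvgrPdist_le/(_ _ eps0) h2 := vv.
  have /filter_ex[k [k1 k2]] : \forall k \near \oo,
    `|0 - t_ k| <= eps /\ `|v - v_ k| <= eps by exact: filterI.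
  exists (t_ k), (v_ k); split => //; last by rewrite distrC.
  by move: k1; rewrite sub0r normrN gtr0_norm.
have seqP k : exists p : R * V, [/\ 0 < p.1, p.1 <= k.+1%:R^-1,
    `|p.2 - v| <= k.+1%:R^-1 & S (x + p.1 *: p.2)].
  have [|t [u h]] := H (k.+1%:R^-1); first by rewrite invr_gt0.
  by exists (t, u).
have [p hp] := choice seqP.
have small eps : 0 < eps -> \forall k \near \oo, k.+1%:R^-1 <= eps :> R.
  by move=> e0; apply: (cvgr_le _ (@cvg_harmonic R) _ e0).
exists (fun k => (p k).1), (fun k => (p k).2); split.
- by move=> k; have [] := hp k.
- apply/cvgrPdist_le => e e0; apply: filterS (small e e0) => k.
  have [h0 h _ _] := hp k; rewrite sub0r normrN gtr0_norm //; exact: le_trans.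
- apply/cvgrPdist_le => e e0; apply: filterS (small e e0) => k.
  by have [_ _ h _] := hp k; rewrite distrC; exact: le_trans.
- by move=> k; have [] := hp k.
Qed.

(** * Minimisation with a smooth penalty *)

Lemma compact_norm_ball (R : realType) (n : nat) (x : 'rV[R]_n) (r : R) :
  0 <= r -> compact [set y | `|y - x| <= r].
Proof.
move=> r0.
rewrite (_ : [set y | _] = [set y : 'rV[R]_n |
    forall i, `[x ord0 i - r, x ord0 i + r]%classic (y ord0 i)]).
  apply: (@rV_compact _ _ (fun i => `[x ord0 i - r, x ord0 i + r]%classic)) => i.
  exact: segment_compact.
apply/seteqP; split=> y /= h.
  move=> i; rewrite in_itv /=.
  have := le_trans (coord_norm_le (y - x) ord0 i) h.
  by rewrite rowBE ler_norml; lra.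
apply: norm_le_coord => // i; have := h i.
by rewrite in_itv /= rowBE ler_norml; lra.
Qed.

Lemma dot_continuous (R : realType) (n : nat) (T : topologicalType)
    (u v : T -> 'rV[R]_n) (x : T) :
  {for x, continuous u} -> {for x, continuous v} ->
  {for x, continuous (fun y => dot (u y) (v y))}.
Proof.
move=> cu cv; apply: cvg_big => [|i _]; first exact: add_continuous.
apply: cvgM.
  exact: (@cvg_comp _ _ _ u (fun w : 'rV[R]_n => w ord0 i) _ _ _ cu
    (@coord_continuous _ _ _ _ _ _)).
exact: (@cvg_comp _ _ _ v (fun w : 'rV[R]_n => w ord0 i) _ _ _ cv
  (@coord_continuous _ _ _ _ _ _)).
Qed.

Lemma penalty_continuous (R : realType) (n : nat) (x v : 'rV[R]_n) (c : R) :
  continuous (fun y : 'rV[R]_n => c * dot (y - x) (y - x) - dot v (y - x)).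
Proof.
move=> y.
have cs : {for y, continuous (fun z : 'rV[R]_n => z - x)}.
  exact: (@cvgB _ _ _ (nbhs y) _ id (cst x) y x (@cvg_id _ (nbhs y))
    (@cvg_cst _ x _ (nbhs y) _)).
have c1 := dot_continuous cs cs.
have c2 := dot_continuous (@cst_continuous _ _ v y) cs.
have c3 : {for y, continuous (fun z : 'rV[R]_n => c * dot (z - x) (z - x))}.
  apply: (@cvgM _ _ (nbhs y) _ (cst c)); first exact: cvg_cst.
  exact: c1.
apply: (@cvgB _ R^o _ (nbhs y) _ (fun z => c * dot (z - x) (z - x))
  (fun z => dot v (z - x))); [exact: c3|exact: c2].
Qed.

(* The penalty [M |y - x|] is replaced by the smooth [c |y - x|^2] with
   [c = 2 M / r], which is at least [M |y - x|] once [|y - x| >= r / 2]; hence a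
   minimiser over the ball of radius [r] lies in the half ball, where the gradient
   of the smooth penalty is at most [2 M]. *)
Lemma fuzzy_frechet (R : realType) (n : nat) (f : 'rV[R]_n -> \bar R)
    (x v : 'rV[R]_n) (M eta d : R) : ninfty_free f -> (f x < +oo)%E ->
  0 < M -> 0 < eta -> 0 < d ->
  (forall y : 'rV[R]_n, `|y - x| <= d -> lsc_at f y) ->
  (forall y : 'rV[R]_n, `|y - x| <= d ->
    (f x + (dot v (y - x) - M * `|y - x|)%:E <= f y)%E) ->
  exists x' v', [/\ `|x' - x| <= eta, `|fine (f x') - fine (f x)| <= eta,
    `|v' - v| <= 2 * M & frechet_subdiff f x' v'].
Proof.
move=> nf fx M0 eta0 d0 lsc low.
have ffin := ninfty_fin nf fx.
have [d1 d10 hd1] : exists2 d1, 0 < d1 & forall y, `|y - x| <= d1 ->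
    ((fine (f x) - eta)%:E < f y)%E.
  have : \forall y \near x, ((fine (f x) - eta)%:E < f y)%E.
    apply: (lsc x); first by rewrite subrr normr0 ltW.
    by rewrite -[X in (_ < X)%E](fineK ffin) lte_fin; lra.
  move=> /nbhs_ballP[e /= e0 he]; exists (e / 2); first by lra.
  by move=> y yx; apply: he; rewrite -ball_normE /= distrC; lra.
set V := n%:R * `|v| + 1; have V0 : 0 < V by rewrite ltr_wpDl // mulr_ge0.
(* [r <= d] keeps the hypotheses in force on the ball, [r <= d1] prevents [f] from dropping by [eta]
   there, and [r <= eta / V] bounds the linear term by [eta], so that [f x'] exceeds [f x] by at
   most [eta]. *)
pose r := Num.min (Num.min d d1) (Num.min eta (eta / V)).
have r0 : 0 < r by rewrite !lt_min d0 d10 eta0 divr_gt0.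
have rd : r <= d by rewrite !ge_min lexx.
have rd1 : r <= d1 by rewrite !ge_min lexx orbT.
have reta : r <= eta by rewrite !ge_min lexx !orbT.
have rV : r <= eta / V by rewrite !ge_min lexx !orbT.
pose c := 2 * M / r; have c0 : 0 < c by rewrite divr_gt0 // mulr_gt0.
pose p (y : 'rV[R]_n) : R := c * dot (y - x) (y - x) - dot v (y - x).
pose h (y : 'rV[R]_n) : \bar R := (f y + (p y)%:E)%E.
have cp := @penalty_continuous R n x v c.
have [||x' x'r hx'] := @lsc_min R 'rV[R]_n h _ (@compact_norm_ball R n x r (ltW r0)).
- by exists x => /=; rewrite subrr normr0 ltW.
- move=> y /= yr; apply: (@lsc_atD _ _ f p); last exact: cp.
  by apply: lsc; exact: le_trans rd.
rewrite /= in x'r.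
have x0 : `|x - x| <= r by rewrite subrr normr0 ltW.
have hx : h x = f x by rewrite /h /p subrr !dot0r mulr0 subr0 adde0.
have fx' : (f x' < +oo)%E.
  rewrite ltey; apply/eqP => fxy; have := hx' x x0.
  by rewrite hx /h fxy addye // leye_eq => /eqP e; rewrite e in fx.
have f'fin := ninfty_fin nf fx'.
have := hx' x x0; have := hd1 x' (le_trans x'r rd1); have := low x' (le_trans x'r rd).
rewrite hx /h -(fineK ffin) -(fineK f'fin) -!EFinD !lee_fin lte_fin /p /=.
set F := fine (f x); set F' := fine (f x'); set w := x' - x in x'r *.
move=> l1 l2 l3.
have cw : c * `|w| ^+ 2 <= c * dot w w by rewrite ler_pM2l // norm_sqr_le_dot.
have w2 : `|w| <= r / 2.
  have [->|w0] := eqVneq `|w| 0; first by lra.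
  have wp : 0 < `|w| by rewrite lt_neqAle eq_sym w0 normr_ge0.
  have : c * `|w| * `|w| <= M * `|w| by rewrite expr2 in cw; lra.
  have cr : c * (r / 2) = M by rewrite /c; field; rewrite gt_eqF.
  by rewrite (ler_pM2r wp) -cr ler_pM2l.
have dv : `|dot v w| <= eta.
  apply: le_trans (dot_le _ _) _.
  apply: (@le_trans _ _ (V * (eta / V))); last by rewrite mulrC divfK // gt_eqF.
  by apply: ler_pM => //; [rewrite /V lerDl|exact: le_trans rV].
have dw0 : 0 <= c * dot w w.
  by apply: le_trans cw; rewrite mulr_ge0 ?sqr_ge0 // ltW.
(* Since [x'] minimises [f + p], minus the gradient of [p] at [x'] is a Frechet subgradient of
   [f]. *)
exists x', (v - (2 * c) *: w); split.
- exact: le_trans reta.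
- by rewrite -/F -/F'; move: dv; rewrite !ler_norml; lra.
- rewrite addrAC subrr add0r normrN normrZ.
  have c2 : 0 < 2 * c by rewrite mulr_gt0.
  rewrite (gtr0_norm c2); have -> : 2 * M = 2 * c * (r / 2) by rewrite /c; field; rewrite gt_eqF.
  by rewrite ler_pM2l.
apply/frechetP => //; split => // eps eps0.
have cn : 0 < c * (n%:R + 1) by rewrite mulr_gt0 // ltr_wpDl.
exists (Num.min (r / 2) (eps / (c * (n%:R + 1)))).
  by rewrite lt_min !divr_gt0.
move=> y; rewrite le_min => /andP[y1 y2].
have yx : y - x = w + (y - x') by rewrite /w [RHS]addrC subrKA.
have yr : `|y - x| <= r.
  by rewrite yx; apply: le_trans (ler_normD _ _) _; lra.
have := hx' y yr; rewrite /h -(fineK f'fin) -/F'.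
case: (f y) (nf y) => [q _|_ _|//]; last by rewrite leey.
rewrite -!EFinD !lee_fin /p -/w yx; move: (y - x') y1 y2 => u u1 u2.
clearbody w; rewrite !(dotDl, dotDr, dotNl, dotZl) (dotC u w).
(* After expanding [p] at [x'], only its quadratic term is left to be absorbed by [eps]. *)
have cu : c * dot u u <= eps * `|u|.
  have := le_trans (ler_norm _) (dot_le u u) => h1.
  have u0 := normr_ge0 u.
  apply: (@le_trans _ _ (c * (n%:R + 1) * `|u| * `|u|)).
    have uu : 0 <= `|u| * `|u| by rewrite mulr_ge0.
    have {}h1 : dot u u <= (n%:R + 1) * (`|u| * `|u|) by lra.
    by have := ler_wpM2l (ltW c0) h1; lra.
  apply: ler_wpM2r => //; rewrite mulrC -ler_pdivlMr //.
lra.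
Qed.

(** * Adding a function with a quadratic expansion *)

Lemma quad_approx_local_lip (R : realType) (n : nat) (s : 'rV[R]_n -> R)
    (g : 'rV[R]_n) (A : 'M[R]_n) (xb : 'rV[R]_n) : quad_approx s g A xb ->
  exists r L, [/\ 0 < r, 0 < L & forall x y, `|x - xb| <= r ->
    `|y - xb| <= r -> `|s y - s x| <= L * `|y - x|].
Proof.
move=> H; have [r r0 hr] := H 1 ltr01.
pose C := n%:R * `|A|; have C0 : 0 <= C by rewrite mulr_ge0.
have n0 : 0 <= n%:R :> R by [].
pose L := n%:R * (`|g| + C * r) + n%:R * (C * r) + 2 * r + 1.
have L0 : 0 < L.
  by rewrite /L ltr_wpDl // !addr_ge0 // ?mulr_ge0 ?addr_ge0 ?mulr_ge0 // ltW.
exists r, L; split => // x y xr yr.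
set u := y - x; have u0 := normr_ge0 u.
have ur : `|u| <= 2 * r.
  rewrite /u (_ : y - x = (y - xb) - (x - xb)); last by rewrite opprB addrA subrK.
  by apply: le_trans (ler_normB _ _) _; lra.
have := hr x y xr yr; rewrite -/u mul1r => h.
have d1 : `|dot (g + mxapp A (x - xb)) u| <= n%:R * (`|g| + C * r) * `|u|.
  apply: le_trans (dot_le _ _) _; apply: ler_wpM2r => //; apply: ler_wpM2l => //.
  apply: le_trans (ler_normD _ _) _; rewrite lerD2l.
  by apply: le_trans (mxapp_le _ _) _; rewrite ler_wpM2l.
have d2 : `|dot (mxapp A u) u| <= 2 * (n%:R * (C * r) * `|u|).
  apply: le_trans (dot_le _ _) _; rewrite mulrA; apply: ler_wpM2r => //.
  rewrite mulrCA; apply: ler_wpM2l => //.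
  apply: le_trans (mxapp_le _ _) _.
  by have := ler_wpM2l C0 ur; rewrite -/C; lra.
have d3 : (`|x - xb| + `|y - xb|) * `|u| <= 2 * r * `|u|.
  by apply: ler_wpM2r => //; lra.
have h' := le_trans h d3.
rewrite /L; move: h' d1 d2; rewrite !ler_norml !mulrDl; lra.
Qed.

(** As [y] tends to [x], the coefficient [eps * (|x - xb| + |y - xb|)] tends to
    [2 * eps * |x - xb|]. All terms quadratic in [y - x], including the quadratic form of [A], are
    absorbed by [eta]. *)
Lemma quad_approx_lower (R : realType) (n : nat) (s : 'rV[R]_n -> R)
    (g : 'rV[R]_n) (A : 'M[R]_n) (xb : 'rV[R]_n) (eps : R) :
  quad_approx s g A xb -> 0 < eps ->
  exists2 r, 0 < r & forall x eta, `|x - xb| <= r -> 0 < eta ->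
    exists2 d, 0 < d & forall y, `|y - x| <= d ->
      s x + dot (g + mxapp A (x - xb)) (y - x)
        - (2 * eps * `|x - xb| + eta) * `|y - x| <= s y.
Proof.
move=> H eps0; have [r r0 hr] := H _ eps0.
exists (r / 2); first by lra.
move=> x eta xr eta0.
pose C := n%:R * (n%:R * `|A|) + eps.
have C0 : 0 < C by rewrite /C ltr_wpDl // !mulr_ge0.
exists (Num.min (r / 2) (eta / (2 * C))).
  by rewrite lt_min !divr_gt0 // mulr_gt0.
move=> y; rewrite le_min => /andP[y1 y2].
have yxb : `|y - xb| <= `|x - xb| + `|y - x|.
  rewrite (_ : y - xb = (x - xb) + (y - x)); last by rewrite [RHS]addrC subrKA.
  exact: ler_normD.
have xr' : `|x - xb| <= r by lra.
have yr' : `|y - xb| <= r by lra.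
have := hr x y xr' yr'; set u := y - x in y1 y2 yxb *.
have u0 := normr_ge0 u; have x0 := normr_ge0 (x - xb).
have d2 : `|dot (mxapp A u) u| <= n%:R * (n%:R * `|A|) * `|u| * `|u|.
  apply: le_trans (dot_le _ _) _; apply: ler_wpM2r => //.
  by rewrite -[leRHS]mulrA; apply: ler_wpM2l => //; exact: mxapp_le.
have Cu : C * `|u| * `|u| <= eta / 2 * `|u|.
  apply: ler_wpM2r => //.
  have : C * `|u| <= C * (eta / (2 * C)) by rewrite ler_pM2l.
  by have -> : C * (eta / (2 * C)) = eta / 2 by field; rewrite gt_eqF.
have e1 : eps * (`|x - xb| + `|y - xb|) * `|u| <=
    eps * (2 * `|x - xb| + `|u|) * `|u|.
  by apply: ler_wpM2r => //; apply: ler_wpM2l; [exact: ltW|lra].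
have uu : 0 <= `|u| * `|u| by rewrite mulr_ge0.
have nu : 0 <= n%:R * (n%:R * `|A|) * `|u| * `|u| by rewrite !mulr_ge0.
have eu : 0 <= eps * `|u| * `|u| by rewrite -mulrA mulr_ge0 // ltW.
have etau : 0 <= eta * `|u| by rewrite mulr_ge0 // ltW.
move=> h; have := le_trans h e1; move: d2 Cu.
rewrite /C !ler_norml !mulrDl !mulrDr !mulrDl; lra.
Qed.

(** Stated for a general pair with [f2 = f1 + s] near [xb], it serves for adding [phi] as well as
    [- phi]. A Frechet subgradient of [f1] near [(x, v)] plus the slope of the model of [s] is a
    subgradient of [f2] up to a slope error [M], which [fuzzy_frechet] removes at a nearby point. *)
Lemma transfer_step (R : realType) (n : nat) (f1 f2 : 'rV[R]_n -> \bar R)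
    (s : 'rV[R]_n -> R) (g xb : 'rV[R]_n) (A : 'M[R]_n) (r0 eps : R) :
  ninfty_free f1 -> ninfty_free f2 -> 0 < r0 ->
  (forall y : 'rV[R]_n, `|y - xb| <= r0 ->
    f2 y = (f1 y + (s y)%:E)%E /\ lsc_at f2 y) ->
  quad_approx s g A xb -> 0 < eps ->
  exists2 r, 0 < r & forall x v eta, `|x - xb| <= r -> 0 < eta ->
    limiting_subdiff f1 x v ->
    exists x' v', [/\ `|x' - x| <= eta, `|fine (f2 x') - fine (f2 x)| <= eta,
      `|v' - (v + g + mxapp A (x - xb))| <= eps * `|x - xb| + eta &
      frechet_subdiff f2 x' v'].
Proof.
move=> nf1 nf2 r00 f12 sH eps0.
have e4 : 0 < eps / 4 by lra.
have [r1 r10 h1] := quad_approx_lower sH e4.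
have [r2 [L [r20 L0 h2]]] := quad_approx_local_lip sH.
pose r := Num.min r0 (Num.min r1 r2).
have rp : 0 < r by rewrite !lt_min r00 r10.
have rr0 : r <= r0 by rewrite !ge_min lexx.
have rr1 : r <= r1 by rewrite !ge_min lexx orbT.
have rr2 : r <= r2 by rewrite !ge_min lexx !orbT.
exists (r / 2); first by lra.
move=> x v eta xr eta0 lx; have [fx1 lxP] := (limitingP _ _ nf1).1 lx.
pose C := n%:R * `|A|; have C0 : 0 <= C by rewrite mulr_ge0.
(* [B] collects the coefficients of all errors caused by moving from [x] to [x1]; together they cost
   at most [eta / 4]. *)
pose B := 1 + C + eps + L; have B0 : 1 <= B by rewrite /B; lra.
have B4 : 0 < 4 * B by lra.
pose e := Num.min (r / 4) (eta / (4 * B)).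
have e0 : 0 < e by rewrite lt_min !divr_gt0.
have er : e <= r / 4 by rewrite ge_min lexx.
have eB : e * B <= eta / 4.
  apply: (@le_trans _ _ (eta / (4 * B) * B)).
    by apply: ler_wpM2r; [lra|rewrite ge_min lexx orbT].
  by rewrite le_eqVlt; apply/orP; left; apply/eqP; field; rewrite gt_eqF //; lra.
have [eC0 ee0 eL0] : [/\ 0 <= e * C, 0 <= e * eps & 0 <= e * L].
  by split; rewrite mulr_ge0 // ltW.
have eB' : e + e * C + e * eps + e * L <= eta / 4.
  by move: eB; rewrite /B !mulrDr mulr1.
have [x1 [v1 [x1x fx1x v1v F1]]] := lxP e e0.
have x1xb : `|x1 - xb| <= `|x - xb| + e.
  rewrite (_ : x1 - xb = (x - xb) + (x1 - x)); last by rewrite [RHS]addrC subrKA.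
  by apply: le_trans (ler_normD _ _) _; rewrite lerD2l.
have x0 := normr_ge0 (x - xb); have x10 := normr_ge0 (x1 - xb).
have x1r1 : `|x1 - xb| <= r1 by lra.
have eta8 : 0 < eta / 8 by lra.
have [d d0 hd] := h1 x1 _ x1r1 eta8.
have [fx1' F1P] := (frechetP _ _ nf1).1 F1.
have [d' d'0 hd'] := F1P _ eta8.
pose v2 := v1 + (g + mxapp A (x1 - xb)).
(* [fuzzy_frechet] loses [2 * M], which is [eps * |x1 - xb| + eta / 2]; hence the quarter of
   [eps]. *)
pose M := 2 * (eps / 4) * `|x1 - xb| + eta / 8 + eta / 8.
have M0 : 0 < M by rewrite /M; have := mulr_ge0 (ltW eps0) x10; lra.
have f1fin := ninfty_fin nf1 fx1; have f1fin' := ninfty_fin nf1 fx1'.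
have x1r0 : `|x1 - xb| <= r0 by lra.
have xr0 : `|x - xb| <= r0 by lra.
have [f2x1 _] := f12 x1 x1r0; have [f2x _] := f12 x xr0.
have f2x1lt : (f2 x1 < +oo)%E by rewrite f2x1 -(fineK f1fin') -EFinD ltry.
pose D := Num.min (r / 4) (Num.min d d').
have D0 : 0 < D by rewrite !lt_min d0 d'0 divr_gt0.
have Dball y : `|y - x1| <= D -> `|y - xb| <= r0.
  rewrite !le_min => /and3P[yr _ _].
  rewrite (_ : y - xb = (x1 - xb) + (y - x1)); last by rewrite [RHS]addrC subrKA.
  by apply: le_trans (ler_normD _ _) _; lra.
have [|||x' [v' [x'x1 fx'x1 v'v2 F']]] :=
    @fuzzy_frechet R n f2 x1 v2 M (eta / 4) D nf2 f2x1lt M0 _ D0.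
- by lra.
- by move=> y /Dball yr; have [] := f12 y yr.
- move=> y yD; have [-> _] := f12 y (Dball y yD).
  move: yD; rewrite !le_min => /and3P[_ yd yd'].
  have := hd y yd; have := hd' y yd'; rewrite f2x1 -(fineK f1fin').
  case: (f1 y) (nf1 y) => [q _|_ _ _|//]; last by rewrite leey.
  rewrite -!EFinD !lee_fin /v2 /M (dotDl _ v1); lra.
exists x', v'; split => //.
- rewrite (_ : x' - x = (x' - x1) + (x1 - x)); last by rewrite subrKA.
  by apply: le_trans (ler_normD _ _) _; lra.
- have sx : `|s x1 - s x| <= L * e.
    apply: (@le_trans _ _ (L * `|x1 - x|)); first by apply: h2; lra.
    by rewrite ler_pM2l.
  have : `|fine (f2 x1) - fine (f2 x)| <= e + L * e.
    rewrite f2x f2x1 -(fineK f1fin) -(fineK f1fin') -!EFinD /=.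
    by move: fx1x sx; rewrite !ler_norml; lra.
  by move: fx'x1; rewrite !ler_norml; lra.
have -> : v' - (v + g + mxapp A (x - xb)) =
    (v' - v2) + (v1 - v) + mxapp A (x1 - x).
  have -> : x1 - x = (x1 - xb) - (x - xb) by rewrite opprB addrA subrK.
  rewrite [in RHS]mxappD [mxapp A (- _)]mxappN /v2.
  move: (mxapp A _) (mxapp A _) => a b.
  by apply/rowP => j; rewrite !mxE; ring.
have a1 : `|mxapp A (x1 - x)| <= C * e.
  by apply: le_trans (mxapp_le _ _) _; rewrite ler_wpM2l.
apply: le_trans (ler_normD _ _) _.
apply: le_trans (lerD (ler_normD _ _) (lexx _)) _.
have a2 : eps * `|x1 - xb| <= eps * (`|x - xb| + e) by rewrite ler_pM2l.
by rewrite /M in v'v2; lra.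
Qed.

Lemma limiting_transfer (R : realType) (n : nat) (f1 f2 : 'rV[R]_n -> \bar R)
    (s : 'rV[R]_n -> R) (g xb v : 'rV[R]_n) (A : 'M[R]_n) (r0 : R) :
  ninfty_free f1 -> ninfty_free f2 -> 0 < r0 ->
  (forall y : 'rV[R]_n, `|y - xb| <= r0 ->
    f2 y = (f1 y + (s y)%:E)%E /\ lsc_at f2 y) ->
  quad_approx s g A xb ->
  limiting_subdiff f1 xb v -> limiting_subdiff f2 xb (v + g).
Proof.
move=> nf1 nf2 r00 f12 sH lv.
have x0 : `|xb - xb| <= 0 by rewrite subrr normr0.
apply/limitingP => //; split.
  have [-> _] := f12 xb (le_trans x0 (ltW r00)).
  by have [fx _] := lv; rewrite -(fineK (ninfty_fin nf1 fx)) -EFinD ltry.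
move=> eps eps0.
have [r rp hr] := transfer_step nf1 nf2 r00 f12 sH ltr01.
have := hr xb v eps (le_trans x0 (ltW rp)) eps0 lv.
by rewrite subrr mxapp0 addr0 normr0 mulr0 add0r.
Qed.

(** With [eta] proportional to [t], the displacement and the subgradient error of [transfer_step] at
    [xb + t *: w1] are at most a small multiple of [t], so they remain small after division by
    [t]. *)
Lemma tangent_transfer (R : realType) (n : nat) (f1 f2 : 'rV[R]_n -> \bar R)
    (s : 'rV[R]_n -> R) (g xb v w z : 'rV[R]_n) (A : 'M[R]_n) (r0 : R) :
  ninfty_free f1 -> ninfty_free f2 -> 0 < r0 ->
  (forall y : 'rV[R]_n, `|y - xb| <= r0 ->
    f2 y = (f1 y + (s y)%:E)%E /\ lsc_at f2 y) ->
  quad_approx s g A xb ->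
  graphical_derivative (limiting_subdiff f1) xb v w z ->
  graphical_derivative (limiting_subdiff f2) xb (v + g) w (mxapp A w + z).
Proof.
move=> nf1 nf2 r00 f12 sH /tangent_coneP[S1 T1].
apply/tangent_coneP; split; first exact: (limiting_transfer nf1 nf2 r00 f12 sH S1).
move=> eps eps0.
pose W := `|w| + 1; have W0 : 0 < W by rewrite ltr_wpDl.
(* Since |w1| <= W, the subgradient error proportional to the distance from [xb] is at most
   [t * (eps / 4)]. *)
have eW : 0 < eps / (4 * W) by rewrite divr_gt0 // mulr_gt0.
have [r rp hr] := transfer_step nf1 nf2 r00 f12 sH eW.
pose C := n%:R * `|A|; have C0 : 0 <= C by rewrite mulr_ge0.
have C1 : 0 < 4 * (C + 1) by lra.
pose e := Num.min (Num.min 1 eps) (Num.min (r / W) (eps / (4 * (C + 1)))).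
have e0 : 0 < e by rewrite !lt_min ltr01 eps0 !divr_gt0.
have e1 : e <= 1 by rewrite !ge_min lexx.
have ee : e <= eps by rewrite !ge_min lexx orbT.
have er : e <= r / W by rewrite !ge_min lexx !orbT.
have eC : e <= eps / (4 * (C + 1)) by rewrite !ge_min lexx !orbT.
have eC' : e * (C + 1) <= eps / 4.
  apply: (@le_trans _ _ (eps / (4 * (C + 1)) * (C + 1))).
    by apply: ler_wpM2r => //; lra.
  by rewrite le_eqVlt; apply/orP; left; apply/eqP; field; rewrite gt_eqF //; lra.
have eC0 : 0 <= e * C by rewrite mulr_ge0 // ltW.
have [t [[w1 z1] [t0 te uw /= S]]] := T1 e e0.
have ww : `|w1 - w| <= e by apply: le_trans uw; rewrite le_max lexx.
have zz : `|z1 - z| <= e by apply: le_trans uw; rewrite le_max lexx orbT.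
have w1W : `|w1| <= W.
  rewrite (_ : w1 = w + (w1 - w)); last by rewrite addrC subrK.
  by apply: le_trans (ler_normD _ _) _; rewrite /W; lra.
have x1E : xb + t *: w1 - xb = t *: w1 by rewrite addrAC subrr add0r.
have x1r : `|xb + t *: w1 - xb| <= r.
  rewrite x1E normrZ gtr0_norm //.
  apply: (@le_trans _ _ (r / W * W)); last by rewrite divfK // gt_eqF.
  by apply: ler_pM => //; [exact: ltW|exact: le_trans er].
have te4 : 0 < t * (eps / 4) by rewrite mulr_gt0 //; lra.
have [x' [v' [x'x _ v'v F']]] := hr _ _ _ x1r te4 S.
exists t, (t^-1 *: (x' - xb), t^-1 *: (v' - (v + g))); split => //.
- exact: le_trans ee.
- rewrite ge_max; apply/andP; split => /=.
    have -> : t^-1 *: (x' - xb) - w = t^-1 *: (x' - (xb + t *: w1)) + (w1 - w).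
      apply/rowP => j; rewrite !mxE; field; exact: lt0r_neq0.
    apply: le_trans (ler_normD _ _) _.
    have : `|t^-1 *: (x' - (xb + t *: w1))| <= eps / 4.
      by rewrite normrZ gtr0_norm ?invr_gt0 // ler_pdivrMl.
    by move: eC'; rewrite mulrDr mulr1; lra.
  have -> : t^-1 *: (v' - (v + g)) - (mxapp A w + z) =
      t^-1 *: (v' - (v + t *: z1 + g + mxapp A (t *: w1)))
      + (z1 - z) + mxapp A (w1 - w).
    rewrite mxappZ mxappD mxappN; move: (mxapp A w) (mxapp A w1) => a b.
    by apply/rowP => j; rewrite !mxE; field; exact: lt0r_neq0.
  apply: le_trans (ler_normD _ _) _.
  apply: le_trans (lerD (ler_normD _ _) (lexx _)) _.
  have b1 : `|t^-1 *: (v' - (v + t *: z1 + g + mxapp A (t *: w1)))| <=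
      eps / 4 + eps / 4.
    rewrite normrZ gtr0_norm ?invr_gt0 // ler_pdivrMl // mulrDr.
    rewrite -x1E; apply: le_trans v'v _; rewrite lerD2r x1E normrZ gtr0_norm //.
    rewrite mulrCA ler_pM2l // mulrAC ler_pdivrMr ?mulr_gt0 //.
    have := ler_wpM2l (ltW eps0) w1W; lra.
  have b2 : `|mxapp A (w1 - w)| <= C * e.
    by apply: le_trans (mxapp_le _ _) _; rewrite ler_wpM2l.
  by move: eC'; rewrite mulrDr mulr1; lra.
have tK (a b : 'rV[R]_n) : a + t *: (t^-1 *: (b - a)) = b.
  by rewrite scalerA divff ?gt_eqF // scale1r addrC subrK.
rewrite /graph_of /= !tK; exact: frechet_limiting.
Qed.

(** * Sums of extended real functions and the three formulas *)

Lemma ninfty_freeD (R : realType) (T : Type) (f g : T -> \bar R) :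
  ninfty_free f -> ninfty_free g -> ninfty_free (f \+ g)%E.
Proof.
move=> nf ng x /=; have := nf x; have := ng x.
by case: (f x) => [a| |]; case: (g x) => [b| |] //= _ _; rewrite -?EFinD ?ltNyr.
Qed.

Lemma lsc_at_near (R : realType) (V : topologicalType) (f g : V -> \bar R)
    (x : V) : (\forall y \near x, f y = g y) -> lsc_at f x -> lsc_at g x.
Proof.
move=> fg fx a; rewrite -(nbhs_singleton fg) => /fx.
by apply: filterS2 fg => y ->.
Qed.

Lemma local_lip_continuous (R : realType) (n : nat) (f : 'rV[R]_n -> R)
    (xb : 'rV[R]_n) (r L : R) : 0 < r -> 0 < L ->
  (forall x y, `|x - xb| <= r -> `|y - xb| <= r ->
    `|f y - f x| <= L * `|y - x|) ->
  forall x, `|x - xb| <= r / 2 -> {for x, continuous f}.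
Proof.
move=> r0 L0 H x xr; apply: (proj2 (@cvgrPdist_le _ R^o _ (nbhs x) _ f (f x))).
move=> e e0.
apply/nbhs_ballP; exists (Num.min (r / 2) (e / L)) => /=.
  by rewrite lt_min !divr_gt0.
move=> y; rewrite -ball_normE /= lt_min => /andP[y1 y2].
have yr : `|y - xb| <= r.
  rewrite (_ : y - xb = (x - xb) - (x - y)); last by rewrite opprB [RHS]addrC subrKA.
  by apply: le_trans (ler_normB _ _) _; lra.
have xr' : `|x - xb| <= r by lra.
apply: le_trans (H _ _ yr xr') _.
by rewrite mulrC -ler_pdivlMr // ltW.
Qed.

Theorem theorem3p1 (R : realType) (n : nat) (phi psi : 'rV[R]_n -> \bar R)
    (xb vb : 'rV[R]_n)
    (phi_ninfty : ninfty_free phi)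
    (phi_diff2 : ext_twice_differentiable phi xb)
    (psi_proper : proper_fun psi)
    (psi_lsc : lsc_around psi xb)
    (vb_sub : limiting_subdiff (phi \+ psi)%E xb vb) :
  [/\ forall w : 'rV[R]_n,
        graphical_derivative (limiting_subdiff (phi \+ psi)%E) xb vb w =
        [set mxapp (hessian phi xb) w + z | z in
          graphical_derivative (limiting_subdiff psi) xb (vb - grad phi xb) w],
      forall w : 'rV[R]_n,
        second_subderivative (phi \+ psi)%E xb vb w =
        ((dot w (mxapp (hessian phi xb) w))%:E
          + second_subderivative psi xb (vb - grad phi xb)%R w)%E &
      forall w : 'rV[R]_n, subderivative psi xb w \is a fin_num ->
      forall z : 'rV[R]_n,
        parabolic_subderivative (phi \+ psi)%E xb w z =
        ((dot w (mxapp (hessian phi xb) w))%:E + (dot (grad phi xb) z)%:E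
          + parabolic_subderivative psi xb w z)%E].
Proof.
have [_ _ exA] := phi_diff2; have [psi_ninfty _] := psi_proper.
(* An extended Hessian exists, so [xget] returns one instead of its default 0. *)
have hA : is_ext_hessian phi xb (hessian phi xb) by exact: (xgetPex 0 exA).
move: (hessian phi xb) hA => A hA.
have qphi := ext_hessian_quad_approx hA.
set g := grad phi xb in qphi *.
have sum_ninfty := ninfty_freeD phi_ninfty psi_ninfty.
have [_ [_ [r1 [_ r10 _ [phi_fin _] _]]]] := ext_hessian_local hA.
have [r2 [L [r20 L0 phi_lip]]] := quad_approx_local_lip qphi.
have /nbhs_ballP[r3 /= r30 psi_lsc3] := psi_lsc.
(* The halves leave room around [y]: [phi] must be finite on a neighbourhood of [y], and its
   continuity is obtained on the half ball only. *)
pose r := Num.min (r1 / 2) (Num.min (r2 / 2) (r3 / 2)).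
have r0 : 0 < r by rewrite !lt_min !divr_gt0.
have rr1 : r <= r1 / 2 by rewrite !ge_min lexx.
have rr2 : r <= r2 / 2 by rewrite !ge_min lexx orbT.
have rr3 : r <= r3 / 2 by rewrite !ge_min lexx !orbT.
have psiE (y : 'rV[R]_n) : `|y - xb| <= r ->
    psi y = ((phi \+ psi)%E y + (- fine (phi y))%:E)%E /\ lsc_at psi y.
  move=> yr; split.
    have yr1 : `|y - xb| <= r1 by lra.
    by rewrite /= EFinN fineK ?phi_fin // addeC addeA
      [(- _ + _)%E]addeC subee ?phi_fin // add0e.
  by apply: psi_lsc3; rewrite -ball_normE /= distrC; lra.
have sumE (y : 'rV[R]_n) : `|y - xb| <= r ->
    (phi \+ psi)%E y = (psi y + (fine (phi y))%:E)%E /\ lsc_at (phi \+ psi)%E y.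
  move=> yr; have yr1 : `|y - xb| <= r1 / 2 by lra.
  split; first by rewrite /= fineK 1?addeC //; apply: phi_fin; lra.
  apply: (@lsc_at_near _ _ (fun x => psi x + (fine (phi x))%:E)%E).
    apply/nbhs_ballP; exists (r1 / 2) => /=; first by rewrite divr_gt0.
    move=> x; rewrite -ball_normE /= => xy; rewrite fineK 1?addeC //.
    apply: phi_fin.
    rewrite (_ : x - xb = (y - xb) - (y - x)); last by rewrite opprB [RHS]addrC subrKA.
    by apply: le_trans (ler_normB _ _) _; lra.
  apply: lsc_atD; first by have [] := psiE y yr.
  by apply: (local_lip_continuous r20 L0 phi_lip); lra.
have [sum_lt _] := vb_sub.
have phib : phi xb \is a fin_num by apply: phi_fin; rewrite subrr normr0 ltW.
have psib : psi xb \is a fin_num.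
  apply: ninfty_fin => //; have := sum_lt => /=; rewrite -(fineK phib).
  by case: (psi xb) => [b| |] //= _; rewrite ltry.
(* Along directions near [w] the values of [phi] are finite, so [fine] does not alter them in the
   quotients. *)
have phi_dir (w : 'rV[R]_n) : exists2 d, 0 < d & forall (t : R) u, 0 < t ->
    t <= d -> `|u - w| <= d -> phi (xb + t *: u) \is a fin_num.
  have W0 : 0 < `|w| + 1 by rewrite ltr_wpDl.
  exists (Num.min 1 (r1 / (`|w| + 1))); first by rewrite lt_min ltr01 divr_gt0.
  move=> t u t0; rewrite !le_min => /andP[_ tr] /andP[u1 _]; apply: phi_fin.
  rewrite addrAC subrr add0r normrZ gtr0_norm //.
  apply: (@le_trans _ _ (r1 / (`|w| + 1) * (`|w| + 1))); last by rewrite divfK ?gt_eqF.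
  apply: ler_pM => //; first exact: ltW.
  rewrite (_ : u = w + (u - w)); last by rewrite [RHS]addrC subrK.
  by apply: le_trans (ler_normD _ _) _; rewrite lerD2l.
split.
- move=> w; apply/seteqP; split=> z.
    (* Adding [- phi] turns the sum back into [psi] and gives this inclusion; adding [phi] to [psi]
       gives the other. *)
    move=> hz; exists (mxapp (- A) w + z).
      exact: (tangent_transfer sum_ninfty psi_ninfty r0 psiE (quad_approxN qphi) hz).
    by rewrite mxappNl addrA subrr add0r.
  move=> [y hy <-]; rewrite -(subrK g vb).
  exact: (tangent_transfer psi_ninfty sum_ninfty r0 sumE qphi hy).
- move=> w; rewrite addeC /second_subderivative.
  pose c (p : R * 'rV[R]_n) := (fine (phi (xb + p.1 *: p.2)) - fine (phi xb)
     - p.1 * dot g p.2) * (2^-1 * p.1 ^+ 2)^-1.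
  rewrite -(@limf_einfDr _ _ _ _ c); last first.
    by apply: dir_filter_cvg => eps eps0; exact: (quad_approx_second w qphi eps0).
  have [d d0 hd] := phi_dir w.
  apply: limf_einf_near; apply: (dir_filter_near d0) => t u t0 td ud /=.
  rewrite -(fineK (hd t u t0 td ud)) -(fineK phib) -(fineK psib).
  rewrite (@fin_add_quotient _ _ _ _ _ _ (t * dot (vb - g) u)); last first.
    by rewrite invr_gt0 mulr_gt0 ?invr_gt0 // exprn_gt0.
  congr (_ + _%:E)%E; rewrite /c /= dotDl dotNl; congr (_ * _); ring.
move=> w subfin z.
(* The shift [dot g w] is exactly the linear term that the quotient of [phi] needs in the parabolic
   formula. *)
have subE : subderivative (phi \+ psi)%E xb w =
    (subderivative psi xb w + (dot g w)%:E)%E.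
  rewrite /subderivative.
  pose c (p : R * 'rV[R]_n) := (fine (phi (xb + p.1 *: p.2)) - fine (phi xb)) * p.1^-1.
  rewrite -(@limf_einfDr _ _ _ _ c); last first.
    by apply: dir_filter_cvg => eps eps0; exact: (quad_approx_first w qphi eps0).
  have [d d0 hd] := phi_dir w.
  apply: limf_einf_near; apply: (dir_filter_near d0) => t u t0 td ud /=.
  rewrite -(fineK (hd t u t0 td ud)) -(fineK phib) -(fineK psib).
  have := @fin_add_quotient _ (psi (xb + t *: u)) (fine (phi (xb + t *: u)))
    (fine (phi xb)) (fine (psi xb)) 0 0 (t^-1).
  by rewrite invr_gt0 => /(_ t0); rewrite !sube0 subr0 addr0 => ->.
rewrite addeC /parabolic_subderivative subE -EFinD -(fineK subfin).
pose c (p : R * 'rV[R]_n) := (fine (phi (xb + p.1 *: w + (2^-1 * p.1 ^+ 2) *: p.2))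
  - fine (phi xb) - p.1 * dot g w) * (2^-1 * p.1 ^+ 2)^-1.
(* The parabola is a straight step of size [t] in a direction that tends to [w], so
   [quad_approx_second] applies; the change of direction contributes [dot g u] after division by
   [2^-1 * t ^+ 2]. *)
have path t (u : 'rV[R]_n) :
    xb + t *: w + (2^-1 * t ^+ 2) *: u = xb + t *: (w + (2^-1 * t) *: u).
  by rewrite scalerDr scalerA addrA; congr (_ + _ *: _); ring.
have dir_close d : 0 < d -> exists2 e, 0 < e & forall (t : R) (u : 'rV[R]_n),
    0 < t -> t <= e -> `|u - z| <= e -> t <= d /\ `|w + (2^-1 * t) *: u - w| <= d.
  move=> d0; have Z0 : 0 < `|z| + 1 by rewrite ltr_wpDl.
  exists (Num.min (Num.min 1 d) (d / (`|z| + 1))).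
    by rewrite !lt_min ltr01 d0 divr_gt0.
  move=> t u t0; rewrite !le_min -!andbA => /and3P[_ td tz] /and3P[u1 _ _].
  split => //; rewrite addrAC subrr add0r normrZ gtr0_norm ?mulr_gt0 ?invr_gt0 //.
  have uz : `|u| <= `|z| + 1.
    rewrite (_ : u = z + (u - z)); last by rewrite [RHS]addrC subrK.
    by apply: le_trans (ler_normD _ _) _; rewrite lerD2l.
  have : t * `|u| <= d / (`|z| + 1) * (`|z| + 1) by apply: ler_pM => //; exact: ltW.
  rewrite divfK ?gt_eqF //; have := mulr_ge0 (ltW t0) (normr_ge0 u); lra.
rewrite -(@limf_einfDr _ _ _ _ c); last first.
  apply: dir_filter_cvg => eps eps0.
  have e2 : 0 < eps / 2 by rewrite divr_gt0.
  have [d d0 hd] := quad_approx_second w qphi e2.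
  have [e e0 he] := dir_close d d0.
  have G0 : 0 < 2 * (n%:R * `|g| + 1) by rewrite mulr_gt0 // ltr_wpDl // mulr_ge0.
  exists (Num.min e (eps / (2 * (n%:R * `|g| + 1)))); first by rewrite lt_min e0 divr_gt0.
  move=> t u t0; rewrite !le_min => /andP[te _] /andP[ue ug].
  have [td ud] := he t u t0 te ue.
  have := hd t (w + (2^-1 * t) *: u) t0 td ud.
  rewrite -path dotDr dotZr /c /=; set N := fine _ - _.
  have -> : (N - t * (dot g w + 2^-1 * t * dot g u)) * (2^-1 * t ^+ 2)^-1 =
     (N - t * dot g w) * (2^-1 * t ^+ 2)^-1 - dot g u.
    by field; rewrite gt_eqF.
  have : `|dot g (u - z)| <= eps / 2.
    apply: le_trans (dot_le _ _) _.
    have := normr_ge0 (u - z); move: ug; rewrite ler_pdivlMr //; lra.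
  rewrite dotDr dotNr !ler_norml; lra.
have [d d0 hd] := phi_dir w; have [e e0 he] := dir_close d d0.
apply: limf_einf_near; apply: (dir_filter_near e0) => t u t0 te ue /=.
have [td ud] := he t u t0 te ue.
have := hd t _ t0 td ud; rewrite -path => phit.
rewrite -(fineK phit) -(fineK phib) -(fineK psib).
rewrite (@fin_add_quotient _ _ _ _ _ _ (t * fine (subderivative psi xb w)));
  last by rewrite invr_gt0 mulr_gt0 ?invr_gt0 // exprn_gt0.
congr (_ + _%:E)%E; rewrite /c /=; congr (_ * _); ring.
Qed.
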